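(* Let $G=(V,E)$ be a graph with irreducible local mechanisms $(\mathcal{M}_x)_{x\in V}$, let $n\ge1$, and consider an ($n$-walker) random walk with local memory on $G$ with initial rotor configuration $\rho$ sampled from the $\mathsf{IUD}$ measure. Then exactly one of the following scenarios holds: (1) $p_{\mathrm{rec}}(\rho)=0$ for almost every $\rho$ sampled from $\mathsf{IUD}$; or (2) $p_{\mathrm{rec}}(\rho)=1$ for almost every $\rho$ sampled from $\mathsf{IUD}$.
   Context: $G=(V,E)$ is a (possibly infinite) simple, connected, locally finite graph; $\mathrm{Ngh}(x)$ is the set of neighbors of $x$. A rotor configuration is a function $\rho:V\to V$ with $\rho(x)\in\mathrm{Ngh}(x)$ for all $x$. Each $x\in V$ is assigned a local mechanism $\mathcal{M}_x$: an irreducible Markov chain with state space $\mathrm{Ngh}(x)$ and transition function $p_x(\cdot,\cdot)$. For $\mathbf{x}=(x^{(1)},\dots,x^{(n)})\in V^n$ and a rotor configuration $\rho$, the ($n$-walker) random walk with local memory (RWLM) with initialization $(\mathbf{x},\rho)$ is the random sequence $(\mathbf{X}_t,\rho_t)_{t\ge0}$, $\mathbf{X}_t=(X_t^{(1)},\dots,X_t^{(n)})$, with $(\mathbf{X}_0,\rho_0)=(\mathbf{x},\rho)$ and the following transitions: given the state at time $t$, let $i\in\{1,\dots,n\}$ with $i\equiv t+1\bmod n$; sample $Y_t$ from $p_{X_t^{(i)}}\big(\rho_t(X_t^{(i)}),\cdot\big)$, independently of the past; set $\rho_{t+1}(X_t^{(i)})=Y_t$ and $\rho_{t+1}(x)=\rho_t(x)$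 for $x\ne X_t^{(i)}$; set $X_{t+1}^{(i)}=Y_t$ and $X_{t+1}^{(j)}=X_t^{(j)}$ for $j\neq i$. The walk is recurrent if every vertex of $G$ is visited infinitely many times. The recurrence probability $p_{\mathrm{rec}}(\rho)$ is the probability that the RWLM with (deterministic) initialization $(\mathbf{x},\rho)$ is recurrent, where $\mathbf{x}\in V^n$ is arbitrary (the value does not depend on the choice of $\mathbf{x}$, though it may depend on $n$). $\mathsf{IUD}$ is the probability measure on rotor configurations of $G$ under which the $\rho(x)$, $x\in V$, are independent and each $\rho(x)$ is uniform on $\mathrm{Ngh}(x)$. *)

(* Defs.v *)
From HB Require Import structures.
From mathcomp Require Import all_boot all_order all_algebra finmap.
From mathcomp Require Import all_classical all_reals all_analysis.

Set Implicit Arguments.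
Unset Strict Implicit.
Unset Printing Implicit Defensive.

Import Order.TTheory GRing.Theory Num.Theory.

Local Open Scope classical_set_scope.
Local Open Scope ring_scope.

(** Simple, connected, locally finite, possibly infinite graphs. Local
    finiteness is built in: the neighbourhood of a vertex is a finite set.
    The one-vertex graph is left out, since it has no rotor configuration
    (and hence no measure on rotor configurations). *)
Record graph := Graph {
  vertex :> choiceType;
  nbr : vertex -> {fset vertex};
  nbr_sym : forall x y, (y \in nbr x) = (x \in nbr y);
  nbr_irr : forall x, x \notin nbr x;
  graph_connected : forall x y, exists2 s : seq vertex,
    path [rel u v | v \in nbr u] x s & last x s = y;
  graph_nontrivial : exists x y : vertex, x != y }.

Lemma nbr_neq0 (G : graph) (x : G) : exists y, y \in nbr x.
Proof.
have [a [b neq_ab]] := graph_nontrivial G.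
have [y neq_yx] : exists y : G, y != x.
  by case: (eqVneq a x) neq_ab => [->|? _]; [exists b; rewrite eq_sym|exists a].
have [[|u s] /= xs ys] := graph_connected x y.
  by rewrite ys eqxx in neq_yx.
by exists u; case/andP: xs.
Qed.

Section Rotor.
Variable G : graph.

(** A map [rho : V -> V] with [rho x] in [Ngh x] for all [x], encoded as a
    dependent function. *)
Definition rotor_config := forall x : G, nbr x.

HB.instance Definition _ := Choice.on rotor_config.
HB.instance Definition _ := isPointed.Build rotor_config
  (fun x => [` xchooseP (nbr_neq0 x)]%fset).

Definition cylinders : set (set rotor_config) :=
  [set C | exists (x : G) (y : nbr x), C = [set rho | rho x = y]].

(** Rotor configurations with the product sigma-algebra. *)
Definition rotor_space := g_sigma_algebraType cylinders.

Record is_IUD (R : realType) (mu : probability rotor_space R) : Prop := {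
  IUD_uniform : forall (x : G) (y : nbr x),
    mu [set rho | rho x = y] = (#|` nbr x|%:R^-1)%:E;
  IUD_independent : forall (s : {fset G}) (A : forall x : G, set (nbr x)),
    mu [set rho | forall x, x \in s -> A x (rho x)] =
    (\prod_(x <- s) mu [set rho | A x (rho x)])%E }.

End Rotor.

(** [kstep q k a b] is the [k]-step transition probability from [a] to [b]. *)
Fixpoint kstep (R : realType) (T : finType) (q : T -> T -> R) (k : nat)
    (a b : T) : R :=
  if k is k'.+1 then \sum_(c : T) q a c * kstep q k' c b else (a == b)%:R.

Record mechanisms (R : realType) (G : graph) := Mechanisms {
  trans :> forall x : G, nbr x -> nbr x -> R;
  trans_ge0 : forall x (y z : nbr x), 0 <= trans y z;
  trans_sum1 : forall x (y : nbr x), \sum_(z : nbr x) trans y z = 1;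
  trans_irreducible : forall x (y z : nbr x),
    exists k : nat, 0 < kstep (trans (x := x)) k y z }.

(** The walker moving between times [t] and [t + 1]. Walkers are numbered from
    [0], so that [i = t + 1 mod n] for [i] in [{1, ..., n}] becomes [t %% n]. *)
Definition turn (n : nat) (n_gt0 : (0 < n)%N) (t : nat) : 'I_n :=
  Ordinal (ltn_pmod t n_gt0).

(** An [n]-walker random walk with local memory with initialization [(x, rho)],
    on an arbitrary probability space. Started from a deterministic state, the
    process up to time [t] takes countably many values, so that the conditional
    law of [Y_t] given the past is given by elementary conditioning on each
    possible value [h] of the past: this is [rwlm_sample]. *)
Record rwlm (R : realType) (G : graph) (p : mechanisms R G) (n : nat)
    (n_gt0 : (0 < n)%N) (x : 'I_n -> G) (rho : rotor_config G) := Rwlm {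
  rwlm_display : measure_display;
  rwlm_space : measurableType rwlm_display;
  rwlm_prob : probability rwlm_space R;
  rwlm_pos : nat -> rwlm_space -> 'I_n -> G;
  rwlm_rotor : nat -> rwlm_space -> rotor_config G;
  rwlm_Y : nat -> rwlm_space -> G;
  rwlm_Y_measurable : forall t (y : G),
    measurable [set w | rwlm_Y t w = y];
  rwlm_pos0 : forall w, rwlm_pos 0 w = x;
  rwlm_rotor0 : forall w, rwlm_rotor 0 w = rho;
  rwlm_sample : forall (t : nat) (h : nat -> ('I_n -> G) * rotor_config G),
    let past := [set w | forall s, (s <= t)%N ->
                   (rwlm_pos s w, rwlm_rotor s w) = h s] in
    let v := (h t).1 (turn n_gt0 t) in
    forall y : nbr v,
    rwlm_prob (past `&` [set w | rwlm_Y t w = val y]) =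
    (rwlm_prob past * (p v ((h t).2 v) y)%:E)%E;
  rwlm_rotorS : forall t w (u : G),
    val (rwlm_rotor t.+1 w u) =
    if u == rwlm_pos t w (turn n_gt0 t) then rwlm_Y t w
    else val (rwlm_rotor t w u);
  rwlm_posS : forall t w (j : 'I_n),
    rwlm_pos t.+1 w j =
    if j == turn n_gt0 t then rwlm_Y t w else rwlm_pos t w j }.

Arguments rwlm_prob {R G p n n_gt0 x rho} r.
Arguments rwlm_pos {R G p n n_gt0 x rho} r.
Arguments rwlm_rotor {R G p n n_gt0 x rho} r.
Arguments rwlm_Y {R G p n n_gt0 x rho} r.

Definition recurrent (G : graph) (n : nat) (X : nat -> 'I_n -> G) : Prop :=
  forall v : G, infinite_set [set t | exists j : 'I_n, X t j = v].

Definition recurrence_prob (R : realType) (G : graph) (p : mechanisms R G)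
    (n : nat) (n_gt0 : (0 < n)%N) (x : 'I_n -> G) (rho : rotor_config G)
    (W : rwlm p n_gt0 x rho) : \bar R :=
  rwlm_prob W [set w | recurrent (rwlm_pos W ^~ w)].

(** [p_rec(rho) = q]: the walk with initial rotor configuration [rho] is
    recurrent with probability [q], whatever the initial positions. *)
Definition p_rec_eq (R : realType) (G : graph) (p : mechanisms R G)
    (n : nat) (n_gt0 : (0 < n)%N)
    (W : forall (x : 'I_n -> G) (rho : rotor_config G), rwlm p n_gt0 x rho)
    (rho : rotor_config G) (q : \bar R) : Prop :=
  forall x : 'I_n -> G, recurrence_prob (W x rho) = q.

(* Main.v *)
Require Import Defs.
From HB Require Import structures.
From mathcomp Require Import all_boot all_order all_algebra finmap perm.
From mathcomp Require Import all_classical all_reals all_analysis.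
From mathcomp Require Import measurable_realfun.
From mathcomp Require Import zify lra.

(** The walk is realised on stacks: to every vertex [v] an independent Markov
    chain of mechanism [p v] started at [rho v] is attached, and the [k]-th
    departure from [v] goes to the [k]-th entry of the stack of [v]
    ([random_symbols_ex], [stack_walk_cylinder]). By irreducibility almost all
    stacks are good: each stack contains every neighbour infinitely often
    ([good_ae]). On good stacks the walk either visits every vertex infinitely
    often or leaves every vertex finitely often, and the latter happens exactly
    when some odometer stabilizes the initial chips ([visits_allP], a least
    action principle). This condition does not depend on where the chips are:
    if [U] stabilizes chips one of which is at [b], move that chip to [a] and let
    it run alone on the part of the stacks that [U] leaves unused; it is either
    transient or reaches [b], and in both cases adding its odometer to [U]
    stabilizes the new chips ([stabilizable_move]). Hence the recurrence
    probability depends only on the rotors ([recurrence_start_indep]).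

    Let [f rho] be this probability. Putting the first walker at [v] and
    conditioning on its step shows that [f], as a function of the rotor at [v]
    alone, is harmonic for the irreducible chain [p v] on a finite set, hence
    constant ([rec_value_update]). So [f] does not change along the walk, which
    means that recurrence is independent of every finite past of the walk, and
    therefore of itself: [f rho] is [0] or [1] for each [rho] ([rec_value_01]).

    Finally [f] is measurable ([measurable_law]) and the event [f rho = 1] is
    unchanged when one rotor is modified. Exchanging two values of one rotor
    preserves the uniform measure, so such an event is independent of each
    finite set of rotors, and has measure [0] or [1] ([IUD_tail]).

    The [n] walkers are kept in a queue: the head moves and goes to the end. *)

Set Implicit Arguments.
Unset Strict Implicit.
Unset Printing Implicit Defensive.

Import Order.TTheory GRing.Theory Num.Theory.
Import numFieldNormedType.Exports.

Local Open Scope classical_set_scope.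
Local Open Scope ring_scope.

(** * Measures determined by a pi-system *)

Section MeasureTools.
Context d (T : measurableType d) (R : realType).
Implicit Types (m : {measure set T -> \bar R}) (A B C : set T).

Lemma pi_system_eq (H : set (set T)) m1 m2 :
  @measurable _ T = <<s H >> -> setI_closed H -> H setT ->
  (m1 setT < +oo)%E -> (forall A, H A -> m1 A = m2 A) ->
  forall A, measurable A -> m1 A = m2 A.
Proof.
move=> mH HI HT fin m12 A mA.
by apply: (measure_unique H (fun=> setT)) => //; rewrite bigcup_const.
Qed.

(** In existential form, the image measure is a plain variable wherever it is
    used and does not carry the measurability proof along. *)
Lemma pushforward_measure_ex d' (T' : measurableType d') m (f : T -> T') :
  measurable_fun setT f ->
  exists m' : {measure set T' -> \bar R},
    forall B : set T', m' B = m (f @^-1` B).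
Proof.
move=> mf.
by unshelve refine (ex_intro _ (pushforward m f : {measure set T' -> \bar R}) _).
Qed.

Lemma restricted_measure_ex m D : measurable D ->
  exists m' : {measure set T -> \bar R}, forall B, m' B = m (B `&` D).
Proof. by move=> mD; exists (mrestr m mD : {measure set T -> \bar R}). Qed.

(** The measures [C |-> m (C `&` A)] and [C |-> m A * m C] agree on a pi-system,
    hence on [A] itself, which gives [m A = m A ^ 2]. *)
Lemma zero_one (H : set (set T)) m A :
  @measurable _ T = <<s H >> -> setI_closed H -> H setT ->
  m setT = 1%E -> measurable A ->
  (forall C, H C -> m (C `&` A) = (m A * m C)%E) ->
  m A = 0%E \/ m A = 1%E.
Proof.
move=> mH HI HT m1 mA indep.
have A1 : (m A <= 1)%E by rewrite -m1 le_measure ?inE.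
have Afin : m A \is a fin_num by rewrite ge0_fin_numE// (le_lt_trans A1) ?ltry.
have [mu muE] := restricted_measure_ex m mA.
have A0 : 0 <= fine (m A) by rewrite fine_ge0.
pose nu : {measure set T -> \bar R} := mscale (NngNum A0) m.
have nuE C : nu C = (m A * m C)%E by rewrite /nu /= /mscale /= fineK.
have : mu A = nu A.
  apply: (pi_system_eq mH HI HT) => //.
    by rewrite muE setTI (le_lt_trans A1) ?ltry.
  by move=> C HC; rewrite nuE muE indep.
rewrite nuE muE setIid -(fineK Afin) -EFinM => -[] /eqP.
rewrite -subr_eq0 -{1}[fine _]mulr1 -mulrBr mulf_eq0 subr_eq0 => /orP[]/eqP e.
  by left; rewrite e.
by right; rewrite -e.
Qed.

Lemma negligible_eq m A B N : m.-negligible N -> measurable A -> measurable B ->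
  (forall w, ~ N w -> A w <-> B w) -> m A = m B.
Proof.
move=> [N' [mN' N'0 NN']] mA mB AB.
have off_null C : measurable C -> m C = m (C `\` N').
  move=> mC; have -> : m C = (m (C `\` N') + m (C `&` N'))%E by exact: measureDI.
  suff -> : m (C `&` N') = 0%E by rewrite adde0.
  by apply: subset_measure0 N'0 => //; exact: measurableI.
rewrite off_null// [RHS]off_null//; congr (m _); apply/seteqP.
by split=> w [Cw nN]; split=> //; apply/AB => // /NN'.
Qed.

End MeasureTools.

(** * Stacks of instructions and the least action principle *)

Definition root (G : graph) : G := sval (cid (graph_nontrivial G)).

Section Stacks.
Local Open Scope nat_scope.
Variable G : graph.
Local Notation o := (root G).
Implicit Types (q : seq G) (v w y : G) (s : G -> nat -> G) (u U : G -> nat).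

(** [q] is the queue of the walkers and [y] the new position of its head; the
    order of the queue records whose turn it is. *)
Definition advance q y : seq G := rcons (behead q) y.

Definition fire u v : G -> nat := fun w => u w + (w == v).

Fixpoint stack_walk s q t : seq G * (G -> nat) :=
  if t is t'.+1 then
    let v := head o (stack_walk s q t').1 in let u := (stack_walk s q t').2 in
    (advance (stack_walk s q t').1 (s v (u v)), fire u v)
  else (q, fun=> 0).

Local Notation stack_queue s q t := (stack_walk s q t).1.
Local Notation odometer s q t := (stack_walk s q t).2.

(** On legal stacks only neighbours of [v] send chips to [v], so this counts all
    arrivals at [v] under the odometer [u]. *)
Definition inflow s u v : nat :=
  \sum_(w <- nbr v) count (fun k => s w k == v) (iota 0 (u w)).

Definition legal s := forall v k, s v k \in nbr v.

Definition good s := legal s /\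
  forall v w, w \in nbr v -> forall K, exists2 k, K <= k & s v k = w.

Definition visits_all (Q : nat -> seq G) :=
  forall v N, exists2 t, N <= t & v \in Q t.

(** After each vertex [v] has fired [U v] times, starting from [eta v] chips, no
    vertex holds a chip. The inequality allows vertices to have fired chips that
    they did not hold: [U] need not come from a legal execution, it only has to
    bound all of them, and such bounds can be added up. *)
Definition stabilizable s (eta : G -> nat) :=
  exists U, forall v, eta v + inflow s U v <= U v.

Lemma size_advance q y : q != [::] -> size (advance q y) = size q.
Proof. by case: q => // a q _; rewrite size_rcons. Qed.

Lemma advance_neq0 q y : advance q y != [::].
Proof. by rewrite -size_eq0 size_rcons. Qed.

Lemma stack_queue_neq0 s q t : q != [::] -> stack_queue s q t != [::].
Proof. by case: t => //= t _; exact: advance_neq0. Qed.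

Lemma size_stack_queue s q t : q != [::] -> size (stack_queue s q t) = size q.
Proof. by move=> q0; elim: t => //= t IH; rewrite size_advance// stack_queue_neq0. Qed.

Lemma count_advance q y v : q != [::] ->
  count_mem v (advance q y) + (v == head o q) = count_mem v q + (v == y).
Proof.
case: q => // a q _; rewrite /advance -cats1 count_cat /= addn0 (eq_sym a) (eq_sym y).
lia.
Qed.

Lemma inflow_fire s u v w : legal s ->
  inflow s (fire u w) v = inflow s u v + (v == s w (u w)).
Proof.
move=> ls; rewrite /inflow.
have -> : (v == s w (u w) : nat) = \sum_(x <- nbr v) (x == w) * (v == s w (u w)).
  rewrite -big_distrl /=.
  have [vE|] := eqVneq v (s w (u w)); last by rewrite muln0.
  have -> : \sum_(x <- nbr v) (x == w : nat) = count_mem w (nbr v).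
    by rewrite -sum1_count [RHS]big_mkcond.
  by rewrite muln1 count_uniq_mem ?fset_uniq// nbr_sym vE ls.
rewrite -big_split /=; apply: eq_bigr => x _; rewrite /fire.
have [->|_] := eqVneq x w; last by rewrite mul0n !addn0.
by rewrite iotaD count_cat /= addn0 mul1n add0n (eq_sym v).
Qed.

Lemma chip_conservation s q t v : legal s -> q != [::] ->
  count_mem v (stack_queue s q t) + odometer s q t v =
  count_mem v q + inflow s (odometer s q t) v.
Proof.
move=> ls q0; elim: t => [|t IH] /=.
  by rewrite /inflow big1_seq.
rewrite inflow_fire// addnA -IH {1}/fire.
set v0 := head o (stack_queue s q t).
have H := count_advance (s v0 (odometer s q t v0)) v (stack_queue_neq0 s t q0).
set a := nat_of_bool (v == head o _) in H *.
set b := nat_of_bool _ in H *.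
by rewrite addnA addnAC H; lia.
Qed.

Lemma inflow_mono s u U v : (forall w, w \in nbr v -> u w <= U w) ->
  inflow s u v <= inflow s U v.
Proof.
move=> uU; rewrite /inflow big_seq [leqRHS]big_seq.
apply: leq_sum => w /uU uUw.
by rewrite -(subnKC uUw) iotaD count_cat leq_addr.
Qed.

Lemma count_head q : q != [::] -> 0 < count_mem (head o q) q.
Proof. by case: q => // a q _ /=; rewrite eqxx. Qed.

(** To fire once more, a vertex [v] that has already fired [U v] times must hold a
    chip; but as long as all vertices obey the bound, [v] has received at most
    [U v] chips, the initial ones included. *)
Lemma least_action s q U : legal s -> q != [::] ->
  (forall v, count_mem v q + inflow s U v <= U v) ->
  forall t v, odometer s q t v <= U v.
Proof.
move=> ls q0 HU; elim=> [|t IH] v //=; rewrite {1}/fire.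
have [->|_] := eqVneq v (head o (stack_queue s q t)); last by rewrite addn0.
set v0 := head o _.
have := chip_conservation t v0 ls q0; have := HU v0.
have := @inflow_mono s (odometer s q t) U v0 (fun w _ => IH w).
have := count_head (stack_queue_neq0 s t q0); rewrite -/v0; lia.
Qed.

Lemma odometer_mono s q v t t' : t <= t' -> odometer s q t v <= odometer s q t' v.
Proof.
move=> /subnKC <-; elim: (t' - t) => [|k IH]; first by rewrite addn0.
by rewrite addnS /=; apply: leq_trans IH _; rewrite leq_addr.
Qed.

Lemma fired_in_turn s q t i : i < size (stack_queue s q t) -> q != [::] ->
  head o (stack_queue s q (t + i)) = nth o (stack_queue s q t) i.
Proof.
move=> + q0; elim: i t => [|i IH] t lti; first by rewrite addn0 nth0.
have sz : size (stack_queue s q t.+1) = size (stack_queue s q t) by rewrite !size_stack_queue.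
rewrite addnS -addSn IH; last by rewrite sz ltnW.
by rewrite /= nth_rcons size_behead nth_behead ltn_predRL lti.
Qed.

Lemma fired_after_visit s q t v : q != [::] -> v \in stack_queue s q t ->
  exists t', odometer s q t v < odometer s q t' v.
Proof.
move=> q0 vq; have lti : index v (stack_queue s q t) < size (stack_queue s q t).
  by rewrite index_mem.
exists (t + index v (stack_queue s q t)).+1 => /=.
rewrite /fire fired_in_turn// nth_index// eqxx addn1 ltnS.
by apply: odometer_mono; rewrite leq_addr.
Qed.

Definition unbounded s q v := forall M, exists t, M <= odometer s q t v.

(** A vertex fired infinitely often sends infinitely many chips to each of its
    neighbours, and at most [size q] of them can be waiting there. *)
Lemma unbounded_nbr s q v w : good s -> q != [::] -> w \in nbr v ->
  unbounded s q v -> unbounded s q w.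
Proof.
move=> [ls gs] q0 wv uv M.
have cnt N : exists K, N <= count (fun k => s v k == w) (iota 0 K).
  elim: N => [|N [K NK]]; first by exists 0.
  have [k Kk sk] := gs v w wv K; exists k.+1.
  rewrite -[k.+1]addn1 iotaD count_cat /= add0n sk eqxx addn0 addn1 ltnS.
  by apply: leq_trans NK _; rewrite -(subnKC Kk) iotaD count_cat leq_addr.
have [K MK] := cnt (M + size q); have [t Kt] := uv K; exists t.
have := chip_conservation t w ls q0.
have := count_size (pred1 w) (stack_queue s q t); rewrite size_stack_queue//.
suff : M + size q <= inflow s (odometer s q t) w by lia.
apply: leq_trans MK _; rewrite /inflow (big_rem v) /=; last by rewrite nbr_sym.
apply: leq_trans _ (leq_addr _ _).
by rewrite -(subnKC Kt) iotaD count_cat leq_addr.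
Qed.

Lemma unbounded_all s q v w : good s -> q != [::] ->
  unbounded s q v -> unbounded s q w.
Proof.
move=> gs q0; have [p pv <-] := graph_connected v w.
elim: p v pv => //= a p IH v /andP[av pa] uv; apply: IH pa _.
exact: unbounded_nbr uv.
Qed.

Lemma visits_all_unbounded s q : q != [::] ->
  visits_all (fun t => stack_queue s q t) <-> forall v, unbounded s q v.
Proof.
move=> q0; split=> [V v M|U v N].
  elim: M => [|M [t Mt]]; first by exists 0.
  have [t' tt' /(fired_after_visit q0)[t'' lt']] := V v t.
  by exists t''; apply: leq_ltn_trans lt'; apply: leq_trans Mt (odometer_mono _ _ _ _).
apply: contrapT => noV.
have [t] := U v (odometer s q N v).+1.
suff const k : odometer s q (N + k) v = odometer s q N v.
  have := @odometer_mono s q v t (N + t) (leq_addl _ _); rewrite const; lia.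
elim: k => [|k IH]; first by rewrite addn0.
rewrite addnS /= /fire -IH; have [vE|] := eqVneq v _; last by rewrite addn0.
case: noV; exists (N + k); first exact: leq_addr.
rewrite vE; case: (stack_queue s q (N + k)) (stack_queue_neq0 s (N + k) q0) => //= a l _.
exact: mem_head.
Qed.

(** The final values of the odometer stabilize the initial chips: once [v] and its
    neighbours have stopped firing no chip remains at [v], since a chip at [v] is
    fired within one round of the queue. *)
Lemma bounded_stabilizable s q : legal s -> q != [::] ->
  (forall v, ~ unbounded s q v) -> stabilizable s (fun v => count_mem v q).
Proof.
move=> ls q0 B.
have lim v : exists T, forall t, odometer s q t v <= odometer s q T v.
  have /existsNP[M HM] := B v.
  have exM : exists m, `[< forall t, odometer s q t v <= m >].
    exists M; apply/asboolP => t; rewrite leqNgt; apply/negP => lt.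
    by apply: HM; exists t; exact: ltnW.
  case: (ex_minnP exM) => m /asboolP Hm mmin; apply: contrapT => /forallNP noT.
  case: m Hm mmin => [|m] Hm mmin.
    by case: (noT 0) => t; rewrite (leq_trans (Hm t)).
  suff : m.+1 <= m by rewrite ltnn.
  apply: mmin; apply/asboolP => t; rewrite leqNgt; apply/negP => lt.
  by case: (noT t) => t'; exact: leq_trans (Hm t') lt.
have {lim} [T HT] := choice lim.
have odometerE v t : T v <= t -> odometer s q t v = odometer s q (T v) v.
  by move=> Tt; apply/eqP; rewrite eqn_leq HT odometer_mono.
exists (fun v => odometer s q (T v) v) => v.
pose t0 := T v + \sum_(w <- nbr v) T w.
have inflowE : inflow s (odometer s q t0) v = inflow s (fun v => odometer s q (T v) v) v.
  apply: eq_big_seq => w wv; rewrite odometerE// /t0 (big_rem w)//=.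
  by rewrite addnCA leq_addr.
rewrite -inflowE -chip_conservation// odometerE ?leq_addr//.
rewrite -[leqRHS]add0n leq_add2r leqn0 -leqn0 leqNgt -has_count.
apply/negP => /hasP[x xq /eqP xv]; move: xq; rewrite xv.
move=> /(fired_after_visit q0)[t']; rewrite odometerE ?leq_addr// ltnNge => /negP.
exact.
Qed.

(** By connectedness the vertices fired infinitely often are all or none on good
    stacks. In the second case the final odometer stabilizes the chips; in the
    first no bound exists, by the least action principle. *)
Lemma visits_allP s q : good s -> q != [::] ->
  visits_all (fun t => stack_queue s q t) <->
  ~ stabilizable s (fun v => count_mem v q).
Proof.
move=> gs q0; have ls := gs.1; rewrite visits_all_unbounded//; split.
  move=> ub [U HU]; have [t] := ub o (U o).+1.
  by rewrite ltnNge (least_action ls q0 HU).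
apply: contra_notP => /existsNP[v nv]; apply: bounded_stabilizable => // w uw.
by apply: nv; exact: unbounded_all uw.
Qed.

Lemma inflowD s u U v :
  inflow s (fun w => U w + u w) v =
  inflow s U v + inflow (fun w k => s w (U w + k)) u v.
Proof.
rewrite /inflow -big_split; apply: eq_bigr => w _ /=.
by rewrite iotaD count_cat add0n -{2}[U w]addn0 iotaDl count_map.
Qed.

Lemma good_shift s U : good s -> good (fun w k => s w (U w + k)).
Proof.
move=> [ls gs]; split=> [v k|v w wv K]; first exact: ls.
have [k lek sk] := gs v w wv (U v + K).
by exists (k - U v); [lia | rewrite subnKC //; lia].
Qed.

(** The chip at [a] is run alone on the stacks [s'] left over by an odometer [U]
    for the chip at [b]. If it is transient, [U] absorbs its whole odometer; if
    not, it reaches [b], where [U] has room for exactly one chip. *)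
Lemma stabilizable_move s (eta : G -> nat) a b : good s ->
  stabilizable s (fun v => eta v + (v == b)) ->
  stabilizable s (fun v => eta v + (v == a)).
Proof.
move=> gs [U HU]; set s' := fun w k => s w (U w + k).
have gs' : good s' by exact: good_shift.
have cnt1 x v : count_mem v [:: x] = (v == x) by rewrite /= addn0 eq_sym.
have [[U1 HU1]|] := pselect (stabilizable s' (fun v => count_mem v [:: a])).
  exists (fun v => U v + U1 v) => v; rewrite inflowD -/s'.
  move: (HU v) (HU1 v); rewrite cnt1; lia.
move=> /(visits_allP gs' (isT : [:: a] != [::])) /(_ b 0)[t _ bt].
exists (fun v => U v + odometer s' [:: a] t v) => v; rewrite inflowD -/s'.
have qt : stack_queue s' [:: a] t = [:: b].
  have := @size_stack_queue s' [:: a] t isT; case: (stack_queue s' [:: a] t) bt => // x [] //.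
  by rewrite inE => /eqP ->.
have := @chip_conservation s' [:: a] t v gs'.1 isT; rewrite qt !cnt1.
by move: (HU v); lia.
Qed.

Lemma stabilizable_queue s q q' : good s -> size q = size q' ->
  stabilizable s (fun v => count_mem v q) ->
  stabilizable s (fun v => count_mem v q').
Proof.
move=> gs.
suff gen eta : size q = size q' ->
    stabilizable s (fun v => eta v + count_mem v q) ->
    stabilizable s (fun v => eta v + count_mem v q').
  exact: (gen (fun=> 0)).
elim: q q' eta => [|b q IH] [|a q'] //= eta [sz] Hb.
have : stabilizable s (fun v => eta v + count_mem v q + (v == b)).
  have [U HU] := Hb; exists U => v; apply: leq_trans (HU v).
  by rewrite (eq_sym b) (addnC (v == b)) addnA.
move=> /(stabilizable_move a gs)[U HU].
have : stabilizable s (fun v => (eta v + (v == a)) + count_mem v q).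
  by exists U => v; rewrite (addnAC (eta v)); exact: HU.
move=> /(IH q' _ sz)[U' HU']; exists U' => v; apply: leq_trans (HU' v).
by rewrite (eq_sym a) addnA.
Qed.

Lemma visits_all_queue s q q' : good s -> size q = size q' -> q != [::] ->
  visits_all (fun t => stack_queue s q t) -> visits_all (fun t => stack_queue s q' t).
Proof.
move=> gs sz q0; have q'0 : q' != [::] by rewrite -size_eq0 -sz size_eq0.
rewrite !visits_allP// => nst st; apply: nst.
exact: stabilizable_queue st.
Qed.

End Stacks.

Local Notation stack_queue s q t := (stack_walk s q t).1.

(** * The space of trajectories *)

Lemma countable_seq T : countable [set: T] -> countable [set: seq T].
Proof.
move=> /countable_injP[f finj]; apply/countable_injP.
exists (fun s => choice.pickle (map f s)) => s t _ _ /(pcan_inj choice.pickleK) st.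
by apply: (inj_map _ st) => x y /finj; apply; rewrite in_setT.
Qed.

(** Vertices are coded by the finite sequences of choices of neighbours leading
    to them from the root. *)
Lemma graph_countable (G : graph) : countable [set: G].
Proof.
pose dec := foldl (fun (v : G) k => nth v (nbr v) k) (root G).
have decP v : exists ks, dec ks = v.
  have [s + <-] := graph_connected (root G) v.
  elim/last_ind: s => [_|s y IH]; first by exists [::].
  rewrite rcons_path last_rcons => /andP[/IH[ks ks_last] ysn].
  exists (rcons ks (index y (nbr (last (root G) s)))).
  by rewrite /dec foldl_rcons -/dec ks_last nth_index.
have [code codeK] := choice decP.
apply/countable_injP; exists (fun v => choice.pickle (code v)).
move=> v w _ _ /= /(pcan_inj choice.pickleK) e.
by rewrite -(codeK v) e codeK.
Qed.

Lemma preimage_countable_measurable d (X : measurableType d) (U : Type)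
    (F : X -> U) (B : set U) : countable [set: U] ->
  (forall u, measurable (F @^-1` [set u])) -> measurable (F @^-1` B).
Proof.
move=> cU mF.
have -> : F @^-1` B = \bigcup_u (if `[< B u >] then F @^-1` [set u] else set0).
  apply/seteqP; split=> [x Bx|x [u _]] /=.
    by exists (F x) => //; rewrite ifT//; exact/asboolP.
  by case: ifPn => // /asboolP Bu ->.
by apply: countable_bigcupT_measurable => // u; case: ifP.
Qed.

Section PathSpace.
Variable G : graph.
Local Notation o := (root G).

Definition path := nat -> G.
HB.instance Definition _ := Choice.on path.
HB.instance Definition _ := isPointed.Build path (fun=> o).

Definition cylinder (ys : seq G) : set path := [set Y | mkseq Y (size ys) = ys].

(** The empty set is added to make the cylinders stable under intersection. *)
Definition path_cylinders : set (set path) :=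
  [set C | C = set0 \/ exists ys, C = cylinder ys].

Definition path_space := g_sigma_algebraType path_cylinders.

Lemma cylinder_nil : cylinder [::] = setT.
Proof. by apply/seteqP; split. Qed.

Lemma cylinderP (Y : path) ys :
  cylinder ys Y <-> forall i, (i < size ys)%N -> Y i = nth o ys i.
Proof.
split=> [YE i lti|H]; first by rewrite -[in RHS]YE nth_mkseq.
apply: (@eq_from_nth _ o); rewrite size_mkseq // => i lti.
by rewrite nth_mkseq// H.
Qed.

Lemma path_cylindersI : setI_closed path_cylinders.
Proof.
suff main ys zs : (size ys <= size zs)%N ->
    path_cylinders (cylinder ys `&` cylinder zs).
  move=> A B [->|[ys ->]] [->|[zs ->]]; rewrite ?set0I ?setI0; try by left.
  case: (leqP (size ys) (size zs)) => [|/ltnW] le; first exact: main.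
  by rewrite setIC; exact: main.
move=> le; have [e|ne] := eqVneq (take (size ys) zs) ys; [right|left].
  exists zs; apply/setIidr => Y /cylinderP Yz; apply/cylinderP => i lti.
  by rewrite Yz ?(leq_trans lti)// -e nth_take.
rewrite -subset0 => Y [/cylinderP Yy /cylinderP Yz]; move/eqP: ne; apply.
apply: (@eq_from_nth _ o); rewrite size_takel // => i lti.
by rewrite nth_take// -Yz -?Yy// (leq_trans lti).
Qed.

Lemma path_cylindersT : path_cylinders setT.
Proof. by right; exists [::]; rewrite cylinder_nil. Qed.

Lemma measurable_cylinder ys : measurable (cylinder ys : set path_space).
Proof. by apply: sub_sigma_algebra; right; exists ys. Qed.

Lemma measurable_mkseq (B : set (seq G)) t :
  measurable ([set Y | B (mkseq Y t)] : set path_space).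
Proof.
apply: (@preimage_countable_measurable _ path_space (seq G) (fun Y => mkseq Y t)).
  exact/countable_seq/graph_countable.
move=> ys; have [e|ne] := eqVneq (size ys) t.
  by rewrite -e; exact: measurable_cylinder.
rewrite (_ : _ @^-1` _ = set0) // -subset0 => Y /= YE.
by rewrite -YE size_mkseq eqxx in ne.
Qed.

Lemma measurable_fun_cylinder d (X : measurableType d) (F : X -> path_space) :
  (forall ys, measurable (F @^-1` cylinder ys)) -> measurable_fun setT F.
Proof.
move=> mF; apply: (@measurability _ _ _ path_space setT F path_cylinders) => //.
by move=> _ [_ [->|[ys ->]] <-]; rewrite setTI ?preimage_set0.
Qed.

Lemma measurable_path_fun d (X : measurableType d) (F : X -> path_space) :
  (forall t y, measurable [set w | F w t = y]) -> measurable_fun setT F.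
Proof.
move=> mF; apply: measurable_fun_cylinder => ys.
rewrite (_ : _ @^-1` _ =
    \bigcap_i (if (i < size ys)%N then [set w | F w i = nth o ys i] else setT)).
  by apply: bigcapT_measurable => i; case: ifP.
apply/seteqP; split=> w.
  by move=> /= /cylinderP Fw i _; case: ifP => // lti; rewrite /= Fw.
by move=> H; apply/cylinderP => i lti; have := H i Logic.I; rewrite lti.
Qed.

Definition queue q (Y : path) t : seq G := foldl (@advance G) q (mkseq Y t).

Definition shift (Y : path) : path := fun t => Y t.+1.

Definition rec_event q : set path_space := [set Y | visits_all (queue q Y)].

Lemma mkseqS_shift (Y : path) t : mkseq Y t.+1 = Y 0%N :: mkseq (shift Y) t.
Proof. by rewrite /mkseq /= (iotaDl 1 0) -map_comp. Qed.

Lemma queueS q Y t : queue q Y t.+1 = advance (queue q Y t) (Y t).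
Proof. by rewrite /queue mkseqS foldl_rcons. Qed.

Lemma queue_shift q Y t : queue q Y t.+1 = queue (advance q (Y 0%N)) (shift Y) t.
Proof. by rewrite /queue mkseqS_shift. Qed.

Lemma rec_event_shift q Y :
  rec_event q Y <-> rec_event (advance q (Y 0%N)) (shift Y).
Proof.
split=> H v N.
  have [[|t] // Nt vt] := H v N.+1; exists t => //.
  by rewrite -queue_shift.
by have [t Nt vt] := H v N; exists t.+1; [exact: leqW | rewrite queue_shift].
Qed.

Lemma measurable_rec_event q : measurable (rec_event q).
Proof.
rewrite (_ : rec_event q = \bigcap_(N : nat) ~` \bigcup_v
   ~` \bigcup_(t in [set t | (N <= t)%N]) [set Y | v \in queue q Y t]).
  apply: bigcapT_measurable => N; apply: measurableC.
  apply: countable_bigcupT_measurable => [|v]; first exact: graph_countable.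
  apply: measurableC; apply: bigcup_measurable => t _.
  exact: (measurable_mkseq (fun ys => v \in foldl (@advance G) q ys)).
apply/seteqP; split=> Y.
  by move=> H N _ [v _]; apply; have [t] := H v N; exists t.
move=> H v N; apply: contrapT => noV; apply: (H N Logic.I); exists v => //.
Qed.

Lemma measurable_shift : measurable_fun setT (shift : path_space -> path_space).
Proof.
apply: measurable_path_fun => t y.
rewrite (_ : [set _ | _] =
  [set Y : path_space | (fun ys => nth o ys t.+1 = y) (mkseq Y t.+2)]).
  exact: (measurable_mkseq (fun ys => nth o ys t.+1 = y) t.+2).
have E (Y : path) : nth o (mkseq Y t.+2) t.+1 = Y t.+1 by rewrite nth_mkseq.
by apply/seteqP; split=> Y; [exact: etrans (E Y) | exact: etrans (esym (E Y))].
Qed.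

End PathSpace.

(** * Independent symbols from nested intervals *)

Section Symbols.
Variables (R : realType) (Ws : nat -> seq R).
Hypothesis Ws_ge0 : forall i z, 0 <= (Ws i)`_z.
Hypothesis Ws_sum1 : forall i, \sum_(z < size (Ws i)) (Ws i)`_z = 1.

Let csum i z : R := \sum_(j < z) (Ws i)`_j.

Let csumS i z : csum i z.+1 = csum i z + (Ws i)`_z.
Proof. by rewrite /csum big_ord_recr. Qed.

Let csum_mono i z z' : (z <= z')%N -> csum i z <= csum i z'.
Proof.
move=> /subnKC <-; elim: (z' - z)%N => [|k IH]; first by rewrite addn0.
by rewrite addnS csumS (le_trans IH)// lerDl.
Qed.

(** The interval from [lo] to [lo + len] is cut into consecutive pieces of relative
    lengths [Ws i]; this is the index of the piece that contains [w]. *)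
Definition cell i (lo len w : R) : nat :=
  find (fun z => w < lo + len * csum i z.+1) (iota 0 (size (Ws i))).

(** The index of the piece chosen at depth [k], each piece being cut again by the
    next weights. *)
Fixpoint digit k i (lo len w : R) : nat :=
  let z := cell i lo len w in
  if k is k'.+1 then digit k' i.+1 (lo + len * csum i z) (len * (Ws i)`_z) w
  else z.

Let cellP i lo len w : 0 <= len -> lo <= w < lo + len ->
  [/\ (cell i lo len w < size (Ws i))%N,
    lo + len * csum i (cell i lo len w) <= w &
    w < lo + len * csum i (cell i lo len w).+1].
Proof.
move=> len0 /andP[low wlo].
have sz0 : (0 < size (Ws i))%N.
  case: (size _) (Ws_sum1 i) => //; rewrite big_ord0 => /esym /eqP.
  by rewrite oner_eq0.
pose P z := w < lo + len * csum i z.+1.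
have hasP : has P (iota 0 (size (Ws i))).
  apply/hasP; exists (size (Ws i)).-1; first by rewrite mem_iota/= prednK.
  by rewrite /P prednK// /csum Ws_sum1 mulr1.
have lt : (cell i lo len w < size (Ws i))%N.
  by move: (hasP); rewrite has_find size_iota.
split => //; last by have := nth_find 0%N hasP; rewrite nth_iota.
case E : (cell i lo len w) => [|z]; first by rewrite /csum big_ord0 mulr0 addr0.
have := @before_find _ 0%N P (iota 0 (size (Ws i))) z.
rewrite -/(cell i lo len w) E => /(_ (leqnn _)).
rewrite nth_iota ?add0n; last by rewrite (ltn_trans _ lt)// E.
by move/negbT; rewrite -leNgt.
Qed.

Let cell_uniq i lo len w z : 0 <= len ->
  lo + len * csum i z <= w < lo + len * csum i z.+1 ->
  lo <= w < lo + len -> cell i lo len w = z.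
Proof.
move=> len0 /andP[h1 h2] /(cellP i len0)[lt h3 h4].
apply/eqP; rewrite eqn_leq; apply/andP; split; rewrite leqNgt; apply/negP => lt'.
- have := ler_wpM2l len0 (csum_mono i lt'); lra.
- have := ler_wpM2l len0 (csum_mono i lt'); lra.
Qed.

Let inside k i lo len (B : nat -> pred nat) : set (measurableTypeR R) :=
  [set w | lo <= w < lo + len /\ forall j, (j < k)%N -> B (i + j)%N (digit j i lo len w)].

Let insideS k i lo len B : 0 <= len ->
  inside k.+1 i lo len B =
  \big[setU/set0]_(z < size (Ws i) | B i z)
     inside k i.+1 (lo + len * csum i z) (len * (Ws i)`_z) B.
Proof.
move=> len0; rewrite -(bigcup_pred [pred z : 'I_(size (Ws i)) | B i z]).
apply/seteqP; split => w.
  move=> [wI H]; have [lt h1 h2] := cellP i len0 wI.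
  exists (Ordinal lt) => /=; first by have := H 0%N (ltn0Sn _); rewrite addn0.
  split; first by rewrite h1 -addrA -mulrDr -csumS.
  by move=> j ltj; rewrite addSnnS; exact: (H j.+1).
move=> [z /= Bz [wI H]].
have wI' : lo + len * csum i z <= w < lo + len * csum i z.+1.
  by rewrite csumS mulrDr addrA.
have wI'' : lo <= w < lo + len.
  have /andP[h1 h2] := wI'.
  have : len * csum i z.+1 <= len * 1.
    by rewrite -(Ws_sum1 i) ler_wpM2l// csum_mono.
  have : 0 <= len * csum i z by rewrite mulr_ge0// sumr_ge0.
  by move=> *; apply/andP; split; lra.
have zE := cell_uniq len0 wI' wI''.
split=> // -[|j] ltj /=; rewrite zE; first by rewrite addn0.
by rewrite -addSnnS; exact: H.
Qed.

Let insideP k i lo len (B : nat -> pred nat) : 0 <= len ->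
  measurable (inside k i lo len B) /\
  lebesgue_measure (inside k i lo len B) =
  (len * \prod_(j < k) \sum_(z < size (Ws (i + j)%N) | B (i + j)%N z) (Ws (i + j)%N)`_z)%:E.
Proof.
elim: k i lo len => [|k IH] i lo len len0.
  rewrite big_ord0 mulr1 (_ : inside _ _ _ _ _ = `[lo, lo + len[%classic).
    split; first exact: measurable_itv.
    rewrite lebesgue_measure_itv /= lte_fin ltrDl.
    case: ltP => [_|len0']; first by rewrite -EFinB addrC addKr.
    by congr EFin; apply/eqP; rewrite eq_le len0 len0'.
  by apply/seteqP; split => w /=; rewrite /inside /= in_itv //= => -[].
have len'0 z : 0 <= len * (Ws i)`_z by rewrite mulr_ge0.
rewrite insideS//; split.
  by apply: bigsetU_measurable => z _; have [] := IH i.+1 (lo + len * csum i z) _ (len'0 z).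
rewrite measure_bigsetU_ord_cond.
- transitivity (\sum_(z < size (Ws i) | B i z) ((len * (Ws i)`_z) *
      \prod_(j < k) \sum_(y < size (Ws (i.+1 + j)%N) | B (i.+1 + j)%N y)
        (Ws (i.+1 + j)%N)`_y)%:E)%E.
    by apply: eq_bigr => z _; have [] := IH i.+1 (lo + len * csum i z) _ (len'0 z).
  rewrite sumEFin -mulr_suml -mulr_sumr -mulrA big_ord_recl addn0.
  congr (_ * (_ * _))%:E; apply: eq_bigr => j _.
  by rewrite (_ : i + lift ord0 j = i.+1 + j)%N // /= /bump /= add1n addnS addSn.
- by move=> z _; have [] := IH i.+1 (lo + len * csum i z) _ (len'0 z).
- apply/trivIsetP => z z' /= _ _ ne; rewrite -subset0 => w [[wI _] [wI' _]].
  move: wI wI'; rewrite -!addrA -!mulrDr -!csumS => /andP[h1 h2] /andP[h3 h4].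
  move: ne; rewrite -val_eqE /= neq_ltn => /orP[] lt;
    have := ler_wpM2l len0 (csum_mono i lt); lra.
Qed.

(** A point of the unit interval, read through nested subdivisions, yields
    independent symbols with arbitrary finite distributions: the length of the
    interval reached after [n] choices is the product of their weights. *)
Lemma independent_symbols :
  exists (m : {measure set (measurableTypeR R) -> \bar R}) (Z : R -> nat -> nat),
  forall (B : nat -> pred nat) n,
    measurable ([set w | forall i, (i < n)%N -> B i (Z w i)] : set (measurableTypeR R))
 /\ m [set w | forall i, (i < n)%N -> B i (Z w i)] =
    (\prod_(i < n) \sum_(z < size (Ws i) | B i z) (Ws i)`_z)%:E.
Proof.
have mI : measurable (`[0, 1[%classic : set (measurableTypeR R)).
  exact: measurable_itv.
have [m mE] := restricted_measure_ex (@lebesgue_measure R) mI.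
exists m, (fun w i => if 0 <= w < 1 then digit i 0 0 1 w else 0%N) => B n.
have [minside muinside] := @insideP n 0 0 1 B ler01.
set S := [set w | _].
have SI : S `&` `[0, 1[%classic = inside n 0 0 1 B.
  apply/seteqP; split=> w /=.
    rewrite in_itv /= => -[H wI]; split; first by rewrite add0r.
    by move=> j /H; rewrite wI.
  rewrite /inside /= add0r in_itv /= => -[wI H]; split=> // i lti.
  by rewrite /S /= wI; exact: H.
split; last by rewrite mE SI; apply: etrans muinside _; rewrite mul1r.
rewrite -(setUIDK S `[0, 1[%classic).
apply: measurableU; first by rewrite SI.
rewrite (_ : _ `\` _ =
  if `[< forall i, (i < n)%N -> B i 0%N >] then ~` `[0, 1[%classic else set0).
  by case: ifP => _ //; exact: measurableC.
case: asboolP => [H|H]; apply/seteqP; split=> w //=.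
- by move=> [].
- move=> nI; split=> // i lti; move: nI; rewrite /S in_itv /= => /negP/negbTE ->.
  exact: H.
- move=> [Sw nI]; apply: H => i lti; have := Sw i lti.
  by move: nI; rewrite in_itv /= => /negP/negbTE ->.
Qed.

End Symbols.

(** * Finite irreducible chains *)

Section FiniteChain.
Variables (R : realType) (T : finType) (q : T -> T -> R).
Hypothesis q_ge0 : forall a b, 0 <= q a b.
Hypothesis q_sum1 : forall a, \sum_b q a b = 1.
Hypothesis q_irr : forall a b, exists k, 0 < kstep q k a b.

Lemma kstep_ge0 k a b : 0 <= kstep q k a b.
Proof.
elim: k a => [|k IH] a /=; first by rewrite ler0n.
by apply: sumr_ge0 => c _; exact: mulr_ge0.
Qed.

(** A property preserved by the transitions of positive probability spreads to
    all states. *)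
Lemma irreducible_closed (P : T -> Prop) :
  (forall a b, P a -> 0 < q a b -> P b) -> forall a b, P a -> P b.
Proof.
move=> clP a b; have [k] := q_irr a b.
elim: k a => [|k IH] a /=.
  by case: eqVneq => [->//|_]; rewrite ltxx.
move=> /lt0r_neq0/eqP /psumr_neq0P[c _|c /= qk Pa].
  by rewrite mulr_ge0// kstep_ge0.
have : 0 < q a c /\ 0 < kstep q k c b.
  move: qk; rewrite !lt0r mulf_eq0 negb_or q_ge0 kstep_ge0.
  by move=> /andP[/andP[-> ->]].
by move=> [qac kcb]; apply: IH kcb _; exact: clP qac.
Qed.

Lemma mean_max (g : T -> R) M a : (forall z, g z <= M) ->
  M <= \sum_z q a z * g z -> forall z, 0 < q a z -> g z = M.
Proof.
move=> gM Ma z qaz.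
have S0 : \sum_z q a z * (M - g z) = 0.
  have ge0 : 0 <= \sum_z q a z * (M - g z).
    by apply: sumr_ge0 => y _; rewrite mulr_ge0// subr_ge0.
  apply/eqP; rewrite eq_le ge0 andbT.
  under eq_bigr do rewrite mulrBr.
  by rewrite sumrB -mulr_suml q_sum1 mul1r subr_le0.
have ge0 y : true -> 0 <= q a y * (M - g y).
  by move=> _; rewrite mulr_ge0// subr_ge0.
have /eqP := @psumr_eq0P _ _ xpredT _ ge0 S0 z isT.
by rewrite mulf_eq0 gt_eqF//= subr_eq0 => /eqP ->.
Qed.

(** The set of maximum points is closed under possible transitions. *)
Lemma harmonic_constant (g : T -> R) :
  (forall a, g a = \sum_z q a z * g z) -> forall a b, g a = g b.
Proof.
move=> harm a b; pose m := [arg max_(i > a) g i]%O.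
have gm z : g z <= g m by rewrite /m; case: arg_maxP => // i _; apply.
have gE z : g z = g m.
  apply: (irreducible_closed (P := fun z => g z = g m)) (erefl (g m)) => c y gc.
  by apply: mean_max => //; rewrite -gc [leLHS]harm.
by rewrite gE (gE b).
Qed.

(** The probability that the chain started at [a] is not at [t] at any of the
    times [1] to [j]. *)
Fixpoint avoid (t : T) j a : R :=
  if j is j'.+1 then \sum_z q a z * (if z == t then 0 else avoid t j' z) else 1.

Lemma avoid_ge0 t j a : 0 <= avoid t j a.
Proof.
elim: j a => [|j IH] a //=; apply: sumr_ge0 => z _.
by rewrite mulr_ge0//; case: ifP.
Qed.

Lemma avoidS_le t j a : avoid t j.+1 a <= avoid t j a.
Proof.
elim: j a => [|j IH] a.
  rewrite /= -[leRHS](q_sum1 a); apply: ler_sum => z _.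
  by rewrite ler_piMr//; case: ifP => _; rewrite ?ler01 ?lexx.
apply: ler_sum => z _; apply: ler_wpM2l => //.
by case: ifP => // _; exact: IH.
Qed.

(** The limit [L] satisfies the same recursion. Where [L] reaches a positive
    maximum, every possible transition leads to another maximum point different
    from [t], so that [t] could never be reached. *)
Lemma avoid_cvg0 t a : avoid t j a @[j --> \oo] --> (0 : R).
Proof.
have cv z : cvgn (fun j => avoid t j z).
  apply: nonincreasing_is_cvgn.
    by apply/nonincreasing_seqP => j; exact: avoidS_le.
  by exists 0 => _ [j _ <-]; exact: avoid_ge0.
pose L z := limn (fun j => avoid t j z).
pose L' z := if z == t then 0 else L z.
have L0 z : 0 <= L z.
  by apply: limr_ge => //; apply: nearW => j; exact: avoid_ge0.
have LE z : L z = \sum_y q z y * L' y.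
  have cvS : avoid t j.+1 z @[j --> \oo] --> \sum_y q z y * L' y.
    apply: cvg_big => [x|y _]; first exact: add_continuous.
    apply: cvgMr; rewrite /L'; case: ifP => _; [exact: cvg_cst|exact: cv].
  by apply: (cvg_lim _) => //; rewrite -cvg_shiftS.
pose m := [arg max_(i > a) L i]%O.
have Lm z : L z <= L m by rewrite /m; case: arg_maxP => // i _; apply.
have L'm z : L' z <= L m by rewrite /L'; case: ifP.
suff Lm0 : L m = 0.
  have -> : 0 = L a by apply/eqP; rewrite eq_le L0 -Lm0 Lm.
  exact: cv.
apply/eqP; apply: contrapT => /negP Lmn0.
have closed z y : L z = L m -> 0 < q z y -> y <> t /\ L y = L m.
  move=> Lz qzy; have := @mean_max L' (L m) z L'm _ y qzy.
  rewrite -LE Lz => /(_ (lexx _)); rewrite /L'; case: eqVneq => [_ e|/eqP//].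
  by rewrite -e eqxx in Lmn0.
have [y _ qmy] : exists2 y, true & 0 < q m y.
  have /psumr_neq0P[//|y /= qy] : \sum_y q m y <> 0.
    by rewrite q_sum1; apply/eqP; exact: oner_neq0.
  by exists y.
have [] // := @irreducible_closed (fun z => z <> t /\ L z = L m) _ y t _.
  by move=> z x [_ Lz] qzx; exact: closed qzx.
exact: closed qmy.
Qed.

End FiniteChain.

(** * Transition weights and random symbols *)

Section Weights.
Variables (R : realType) (G : graph) (p : mechanisms R G).
Local Notation o := (root G).

(** The mechanisms as a total function of vertices, zero outside the
    neighbourhood, so that trajectories need not be legal to have a weight. *)
Definition trans_prob (v a b : G) : R :=
  if insub a is Some a' then
    if insub b is Some b' then p v a' b' else 0
  else 0.

Lemma trans_probE v (a b : nbr v) : trans_prob v (val a) (val b) = p v a b.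
Proof. by rewrite /trans_prob !valK. Qed.

Lemma trans_prob_ge0 v a b : 0 <= trans_prob v a b.
Proof.
rewrite /trans_prob; case: insub => // a'; case: insub => // b'.
exact: trans_ge0.
Qed.

Lemma trans_prob_notin v a b : b \notin nbr v -> trans_prob v a b = 0.
Proof.
move=> bv; rewrite /trans_prob; case: insub => // a'.
by case: insubP => // b'; rewrite (negbTE bv).
Qed.

Lemma trans_prob_sum v (a : nbr v) (f : G -> R) :
  \sum_(b <- nbr v) trans_prob v (val a) b * f b = \sum_(b : nbr v) p v a b * f (val b).
Proof. by rewrite big_seq_fsetE; apply: eq_bigr => b _; rewrite trans_probE. Qed.

Lemma trans_prob_sum1 v a : a \in nbr v -> \sum_(b <- nbr v) trans_prob v a b = 1.
Proof.
move=> av; have := trans_prob_sum [` av]%fset (fun=> 1).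
under eq_bigr do rewrite mulr1.
by under [RHS]eq_bigr do rewrite mulr1; rewrite trans_sum1.
Qed.

Definition update (r : G -> G) v y : G -> G := fun w => if w == v then y else r w.

(** The probability that the walkers in queue [q] with rotors [r] make the
    successive moves [ys]. *)
Fixpoint weight q r ys : R :=
  if ys is y :: ys' then
    let v := head o q in trans_prob v (r v) y * weight (advance q y) (update r v y) ys'
  else 1.

(** [(v, k, a, y)] stands for the event that the [k]-th symbol of [v], read when
    the rotor of [v] is [a], is [y]. *)
Definition entry : Type := G * nat * G * G.

(** Since [u] counts the earlier departures, no symbol is read twice. *)
Fixpoint trace q (r : G -> G) (u : G -> nat) ys : seq entry :=
  if ys is y :: ys' then
    let v := head o q in
    (v, u v, r v, y) :: trace (advance q y) (update r v y) (fire u v) ys'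
  else [::].

Definition entry_prob (e : entry) : R := trans_prob e.1.1.1 e.1.2 e.2.

Lemma weight_trace q r u ys : weight q r ys = \prod_(e <- trace q r u ys) entry_prob e.
Proof.
elim: ys q r u => [|y ys IH] q r u /=; first by rewrite big_nil.
by rewrite big_cons (IH _ _ (fire u (head o q))).
Qed.

Lemma trace_counter q r u ys e : e \in trace q r u ys ->
  (u e.1.1.1 <= e.1.1.2)%N.
Proof.
elim: ys q r u => [|y ys IH] q r u //=; rewrite inE => /orP[/eqP -> //|/IH].
by apply: leq_trans; rewrite /fire leq_addr.
Qed.

Lemma trace_uniq q r u ys : uniq [seq e.1.1 | e <- trace q r u ys].
Proof.
elim: ys q r u => [|y ys IH] q r u //=; rewrite IH andbT.
apply/mapP => -[[[[v k] a] z] /trace_counter /= + [vE kE]].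
by rewrite -vE -kE /fire eqxx addn1 ltnn.
Qed.

Section Symbols.

(** There is one symbol for each vertex, each position in its stack and each
    current rotor. All of them are independent, whereas consecutive entries of a
    stack are not; so whatever the order in which a walk explores the stacks, it
    reads independent symbols. *)
Definition symbols := G -> nat -> G -> G.
Implicit Types S : symbols.

Definition agrees S (l : seq entry) :=
  forall e, e \in l -> S e.1.1.1 e.1.1.2 e.1.2 = e.2.

Fixpoint iterS (S : nat -> G -> G) a k : G :=
  if k is k'.+1 then S k (iterS S a k') else S 0%N a.

Definition stack_of S (r : G -> G) : G -> nat -> G :=
  fun v k => iterS (S v) (r v) k.

End Symbols.

(** The triples formed by a vertex, a position and a rotor are numbered, and the
    [i]-th of a sequence of independent integers selects a neighbour with the law
    prescribed by the [i]-th triple. *)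
Lemma random_symbols_ex :
  exists (m : {measure set (measurableTypeR R) -> \bar R}) (S : R -> symbols),
  (forall w v k a, S w v k a \in nbr v) /\
  forall l : seq entry, (forall e, e \in l -> e.1.2 \in nbr e.1.1.1) ->
    uniq [seq e.1 | e <- l] ->
    measurable ([set w | agrees (S w) l] : set (measurableTypeR R)) /\
    m [set w | agrees (S w) l] = (\prod_(e <- l) entry_prob e)%:E.
Proof.
have [cd cd_inj] : exists cd : G -> nat, injective cd.
  have /countable_injP[cd cdP] := graph_countable G.
  by exists cd => x y; apply: cdP; rewrite in_setT.
pose ix (t : G * nat * G) : nat := choice.pickle (cd t.1.1, t.1.2, cd t.2).
have ix_inj : injective ix.
  move=> [[v k] a] [[v' k'] a'] /(pcan_inj choice.pickleK)[] /=.
  by move=> /cd_inj -> -> /cd_inj ->.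
(* A left inverse of the numbering tells which law the [i]-th symbol has. *)
have [un unK] : exists un : nat -> G * nat * G, cancel ix un.
  have : forall i, exists t, (exists t', ix t' = i) -> ix t = i.
    move=> i; have [[t' <-]|no] := pselect (exists t', ix t' = i).
      by exists t' => _.
    by exists (o, 0%N, o).
  by move=> /choice[un H]; exists un => t; apply: ix_inj; apply: H; exists t.
have /choice[nb nbP] := @nbr_neq0 G.
pose Ws i : seq R := if (un i).2 \in nbr (un i).1.1 then
  [seq trans_prob (un i).1.1 (un i).2 y | y <- nbr (un i).1.1] else [:: 1].
have WsE t : t.2 \in nbr t.1.1 ->
    Ws (ix t) = [seq trans_prob t.1.1 t.2 y | y <- nbr t.1.1].
  by rewrite /Ws unK => ->.
have Ws_ge0 i z : 0 <= (Ws i)`_z.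
  rewrite /Ws; case: ifP => _; last by case: z => [|[|z]] //=; exact: ler01.
  have [lt|le] := ltnP z (size (nbr (un i).1.1)).
    by rewrite (nth_map o)// trans_prob_ge0.
  by rewrite nth_default// size_map.
have Ws_sum1 i : \sum_(z < size (Ws i)) (Ws i)`_z = 1.
  rewrite -(big_mkord xpredT (fun z => (Ws i)`_z)) -(big_nth 0 xpredT id) /Ws.
  by case: ifP => [av|_]; rewrite ?big_map ?trans_prob_sum1// big_seq1.
have [m [Z mZ]] := independent_symbols Ws_ge0 Ws_sum1.
pose S w : symbols := fun v k a => nth (nb v) (nbr v) (Z w (ix (v, k, a))).
exists m, S; split.
  move=> w v k a; rewrite /S.
  have [lt|le] := ltnP (Z w (ix (v, k, a))) (size (nbr v)); first exact: mem_nth.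
  by rewrite nth_default.
move=> l la lu.
pose hit z (e : entry) := nth (nb e.1.1.1) (nbr e.1.1.1) z == e.2.
pose B i z := all (hit z) [seq e <- l | ix e.1 == i].
pose n := (\sum_(e <- l) ix e.1).+1.
have ltn e : e \in l -> (ix e.1 < n)%N.
  by move=> el; rewrite ltnS (big_rem e)//= leq_addr.
have -> : [set w | agrees (S w) l] = [set w | forall i, (i < n)%N -> B i (Z w i)].
  apply/seteqP; split=> w /=.
    move=> H i _; apply/allP => e; rewrite mem_filter => /andP[/eqP <- el].
    by rewrite /hit -(H e el) /S -!surjective_pairing.
  move=> H e el; have /allP/(_ e) := H _ (ltn e el).
  rewrite mem_filter eqxx el => /(_ isT)/eqP <-.
  by rewrite /S -!surjective_pairing.
have [mS ->] := mZ B n; split=> //; congr EFin.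
transitivity (\prod_(i < n) \prod_(e <- l | ix e.1 == i) entry_prob e).
  apply: eq_bigr => i _; rewrite -big_filter /B.
  have : all (fun e => ix e.1 == i) [seq e <- l | ix e.1 == i].
    by apply/allP => e; rewrite mem_filter => /andP[].
  have : uniq [seq e.1 | e <- [seq e <- l | ix e.1 == i]].
    by apply: subseq_uniq lu; apply: map_subseq; exact: filter_subseq.
  have : {subset [seq e <- l | ix e.1 == i] <= l} by exact: mem_subseq (filter_subseq _ _).
  case: [seq _ <- _ | _] => [_ _ _|e [|e' l'] /= sub]; first by rewrite big_nil /= Ws_sum1.
    move=> _ /andP[/eqP <- _]; have av := la e (sub e (mem_head _ _)).
    rewrite big_seq1 WsE// size_map.
    under eq_bigl do rewrite andbT.
    have [yv|yv] := boolP (e.2 \in nbr e.1.1.1); last first.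
      rewrite big1 ?[RHS]/entry_prob ?trans_prob_notin// => z /eqP zE.
      by rewrite -zE mem_nth in yv.
    have ltz : (index e.2 (nbr e.1.1.1) < size (nbr e.1.1.1))%N by rewrite index_mem.
    rewrite (big_pred1 (Ordinal ltz)) /=.
      by rewrite (nth_map (nb e.1.1.1))// nth_index.
    move=> z; rewrite /hit /= -val_eqE /=; apply/eqP/eqP => [<-|->].
      by rewrite index_uniq// fset_uniq.
    by rewrite nth_index.
  rewrite inE => /and3P[/norP[/eqP ne _] _ _] /and3P[/eqP <- /eqP /ix_inj e'E _].
  by case: ne.
rewrite (exchange_big_dep xpredT)//=; apply: eq_big_seq => e el.
by rewrite (big_pred1 (Ordinal (ltn e el)))// => i; rewrite /= -val_eqE /= eq_sym.
Qed.

End Weights.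

(** * The walk read off random stacks *)

Lemma countable_enum T : countable [set: T] -> T ->
  exists e : nat -> T, forall x, exists n, e n = x.
Proof.
move=> /countable_injP[f finj] x0.
have : forall n, exists x, (exists y, f y = n) -> f x = n.
  move=> n; have [[y <-]|no] := pselect (exists y, f y = n).
    by exists y.
  by exists x0.
move=> /choice[e eP]; exists e => x; exists (f x).
by apply: finj; rewrite ?in_setT//; apply: eP; exists x.
Qed.

Section StackWalk.
Variable G : graph.
Local Notation o := (root G).
Implicit Types (q : seq G) (s : G -> nat -> G) (st : seq G * (G -> nat)).

Definition stack_step s st := let v := head o st.1 in
  (advance st.1 (s v (st.2 v)), fire st.2 v).

Definition trajectory s st : path G := fun t =>
  let st' := iter t (stack_step s) st in s (head o st'.1) (st'.2 (head o st'.1)).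

Definition walk_path s q : path_space G := trajectory s (q, fun=> 0%N).

Lemma stack_walk_iter s q t : stack_walk s q t = iter t (stack_step s) (q, fun=> 0%N).
Proof. by elim: t => //= t ->. Qed.

Lemma queue_walk_path s q t : queue q (walk_path s q) t = stack_queue s q t.
Proof.
by elim: t => //= t IH; rewrite queueS IH /walk_path /trajectory -stack_walk_iter.
Qed.

Lemma mkseq_trajectoryS s st n :
  mkseq (trajectory s st) n.+1 = trajectory s st 0 :: mkseq (trajectory s (stack_step s st)) n.
Proof.
rewrite mkseqS_shift; congr cons; apply: eq_mkseq => t.
by rewrite /shift /trajectory iterSr.
Qed.

Lemma agrees_cons (S : symbols G) e l :
  agrees S (e :: l) <-> S e.1.1.1 e.1.1.2 e.1.2 = e.2 /\ agrees S l.
Proof.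
split=> [H|[e1 H] e'].
  by split=> [|e' el]; apply: H; rewrite inE ?eqxx ?el ?orbT.
by rewrite inE => /orP[/eqP ->|/H].
Qed.

(** The hypotheses say that [s] is the stack built from the symbols [S] and that
    [r] holds the entry read last in each stack. *)
Lemma follow_trace (S : symbols G) (r : G -> G) s q u ys :
  (forall v, s v (u v) = S v (u v) (r v)) ->
  (forall v k, s v k.+1 = S v k.+1 (s v k)) ->
  mkseq (trajectory s (q, u)) (size ys) = ys <-> agrees S (trace q r u ys).
Proof.
move=> su sS; elim: ys q r u su => [|y ys IH] q r u su; first by split.
rewrite mkseq_trajectoryS [trace _ _ _ _]/= agrees_cons /=.
have out0 : trajectory s (q, u) 0 = S (head o q) (u (head o q)) (r (head o q)).
  by rewrite /trajectory /= su.
have key : S (head o q) (u (head o q)) (r (head o q)) = y ->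
    mkseq (trajectory s (stack_step s (q, u))) (size ys) = ys <->
    agrees S (trace (advance q y) (update r (head o q) y) (fire u (head o q)) ys).
  move=> Sy; rewrite /stack_step /= su Sy; apply: IH => v; rewrite /fire /update.
  have [->|_] := eqVneq v (head o q); last by rewrite addn0 su.
  by rewrite addn1 sS su Sy.
split=> [[]|[Sy /key H]]; rewrite out0; first by move=> Sy /(key Sy).
by rewrite Sy (H Sy).
Qed.

Lemma trace_valid q (r : G -> G) u ys : (forall v, r v \in nbr v) ->
  (forall e, e \in trace q r u ys -> e.2 \in nbr e.1.1.1) ->
  forall e, e \in trace q r u ys -> e.1.2 \in nbr e.1.1.1.
Proof.
elim: ys q r u => [|y ys IH] q r u rv yv e //=; rewrite inE => /orP[/eqP -> /=|el]; first exact: rv.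
apply: (IH _ _ _ _ _ e el) => [v|e' e'l]; last by apply: yv; rewrite inE e'l orbT.
rewrite /update; case: eqVneq => [->|_]; last exact: rv.
by apply: (yv (head o q, u (head o q), r (head o q), y)); rewrite inE eqxx.
Qed.

Fixpoint stack_trace (v : G) k (a : G) cs : seq (entry G) :=
  if cs is c :: cs' then (v, k, a, c) :: stack_trace v k.+1 c cs' else [::].

Lemma stack_trace_rcons v k a cs z : stack_trace v k a (rcons cs z) =
  rcons (stack_trace v k a cs) (v, (k + size cs)%N, last a cs, z).
Proof.
elim: cs k a => [|c cs IH] k a /=; first by rewrite addn0.
by rewrite IH addSnnS.
Qed.

Lemma stack_trace_uniq v k a cs : uniq [seq e.1 | e <- stack_trace v k a cs].
Proof.
elim: cs k a => [|c cs IH] k a //=; rewrite IH andbT.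
suff counter e : e \in stack_trace v k.+1 c cs -> (k < e.1.1.2)%N.
  by apply/mapP => -[[[[w j] b] z] /counter /= + [_ jk _]]; rewrite jk ltnn.
elim: cs k c {IH} => [|c' cs IH] k c //=; rewrite inE => /orP[/eqP -> //|/IH].
exact: ltnW.
Qed.

Lemma stack_trace_valid v k a cs : a \in nbr v -> {subset cs <= nbr v} ->
  forall e, e \in stack_trace v k a cs -> e.1.2 \in nbr e.1.1.1.
Proof.
elim: cs k a => [|c cs IH] k a av cv e //=; rewrite inE => /orP[/eqP -> //|el].
by apply: (IH _ _ _ _ e el) => [|x xcs]; apply: cv; rewrite inE ?eqxx ?xcs ?orbT.
Qed.

Lemma follow_stack_trace (S : symbols G) (f : nat -> G) v k a cs :
  f 0%N = S v k a -> (forall j, f j.+1 = S v (k + j.+1)%N (f j)) ->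
  mkseq f (size cs) = cs <-> agrees S (stack_trace v k a cs).
Proof.
elim: cs k a f => [|c cs IH] k a f f0 fS; first by split.
have -> : mkseq f (size (c :: cs)) = f 0%N :: mkseq (fun j => f j.+1) (size cs).
  by rewrite /= /mkseq /= (iotaDl 1 0) -map_comp.
rewrite [stack_trace _ _ _ _]/= agrees_cons /= f0.
have key : S v k a = c -> mkseq (fun j => f j.+1) (size cs) = cs <->
    agrees S (stack_trace v k.+1 c cs).
  move=> Sc; apply: IH => [|j]; first by rewrite fS f0 Sc addn1.
  by rewrite fS addSnnS.
split=> [[Sc /(key Sc)]|[Sc /(key Sc) ->]] //; by rewrite Sc.
Qed.

End StackWalk.

Section StackLaw.
Variables (R : realType) (G : graph) (p : mechanisms R G).
Local Notation o := (root G).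
Variable r : G -> G.
Hypothesis r_valid : forall v, r v \in nbr v.
Variables (m : {measure set (measurableTypeR R) -> \bar R}) (S : R -> symbols G).
Hypothesis S_nbr : forall w v k a, S w v k a \in nbr v.
Hypothesis m_symbols : forall l : seq (entry G),
  (forall e, e \in l -> e.1.2 \in nbr e.1.1.1) -> uniq [seq e.1 | e <- l] ->
  measurable ([set w | agrees (S w) l] : set (measurableTypeR R)) /\
  m [set w | agrees (S w) l] = (\prod_(e <- l) entry_prob p e)%:E.

Let stk w : G -> nat -> G := stack_of (S w) r.

Lemma stack_legal w : legal (stk w).
Proof. by move=> v [|k]; exact: S_nbr. Qed.

(** Distinct moves read distinct symbols, whence the product. Moves to a
    vertex that is not a neighbour have weight zero and do not occur. *)
Lemma stack_walk_cylinder q ys :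
  measurable ((fun w => walk_path (stk w) q) @^-1` cylinder ys : set (measurableTypeR R)) /\
  m ((fun w => walk_path (stk w) q) @^-1` cylinder ys) = (weight p q r ys)%:E.
Proof.
have -> : (fun w => walk_path (stk w) q) @^-1` cylinder ys =
    [set w | agrees (S w) (trace q r (fun=> 0%N) ys)].
  have F w := @follow_trace G (S w) r (stk w) q (fun=> 0%N) ys
    (fun=> erefl) (fun _ _ => erefl).
  by apply/seteqP; split=> w /F.
rewrite (weight_trace p q r (fun=> 0%N)).
have [yv|/existsNP[e /not_implyP[el ev]]] := pselect (forall e,
    e \in trace q r (fun=> 0%N) ys -> e.2 \in nbr e.1.1.1).
  apply: m_symbols; first exact: trace_valid.
  by have := trace_uniq q r (fun=> 0%N) ys; rewrite (map_comp fst); exact: map_uniq.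
have -> : [set w | agrees (S w) (trace q r (fun=> 0%N) ys)] = set0.
  by rewrite -subset0 => w /(_ e el) Se; apply: ev; rewrite -Se.
split; first exact: measurable0.
rewrite measure0 (big_rem e)//= {1}/entry_prob trans_prob_notin ?mul0r//.
exact/negP.
Qed.

Let avoiding v (t : G) cs j := [set w | mkseq (stk w v) (size cs) = cs /\
  forall k, (size cs <= k < size cs + j)%N -> stk w v k <> t].

Let avoidingS v t cs j : avoiding v t cs j.+1 =
  \big[setU/set0]_(z <- nbr v)
    (if z == t then set0 else avoiding v t (rcons cs z) j).
Proof.
rewrite -bigcup_seq; apply/seteqP; split=> w.
  move=> [wcs H]; exists (stk w v (size cs)); first exact: stack_legal.
  rewrite ifF; last by apply/eqP; apply: H; rewrite leqnn addnS ltnS leq_addr.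
  split; first by rewrite size_rcons mkseqS wcs.
  by move=> k /andP[]; rewrite size_rcons addSnnS => k1 k2; apply: H; rewrite k2 ltnW.
move=> [z _]; case: eqVneq => // zt [].
rewrite size_rcons mkseqS => /rcons_inj[wcs wz] H; split=> // k /andP[].
rewrite leq_eqVlt => /orP[/eqP <- _|k1 k2]; first by rewrite wz; apply/eqP.
by apply: H; rewrite k1 addSnnS.
Qed.

Let avoidingP v (t a : nbr v) cs j : {subset cs <= nbr v} ->
  last (r v) cs = val a ->
  measurable (avoiding v (val t) cs j : set (measurableTypeR R)) /\
  m (avoiding v (val t) cs j) =
   (\prod_(e <- stack_trace v 0 (r v) cs) entry_prob p e * avoid (p v) t j a)%:E.
Proof.
elim: j cs a => [|j IH] cs a csv csa.
  have -> : avoiding v (val t) cs 0 = [set w | agrees (S w) (stack_trace v 0 (r v) cs)].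
    have F w := @follow_stack_trace G (S w) (stk w v) v 0 (r v) cs erefl (fun=> erefl).
    apply/seteqP; split=> [w [/F]//|w /F wcs].
    by split=> // k; rewrite addn0; case: ltngtP.
  rewrite mulr1; apply: m_symbols; last exact: stack_trace_uniq.
  exact: stack_trace_valid.
have step (z : nbr v) :
    measurable (avoiding v (val t) (rcons cs (val z)) j : set (measurableTypeR R)) /\
    m (avoiding v (val t) (rcons cs (val z)) j) =
    (\prod_(e <- stack_trace v 0 (r v) cs) entry_prob p e * (p v a z * avoid (p v) t j z))%:E.
  have [] := IH (rcons cs (val z)) z.
  - by move=> x; rewrite mem_rcons inE => /orP[/eqP ->|/csv //]; exact: valP.
  - by rewrite last_rcons.
  move=> ms mE; split=> //; rewrite mE stack_trace_rcons -cats1 big_cat big_seq1 /=.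
  by rewrite {2}/entry_prob /= csa trans_probE mulrA.
have ms z : z \in nbr v -> measurable ((if z == val t then set0 else
    avoiding v (val t) (rcons cs z) j) : set (measurableTypeR R)).
  by move=> zv; case: ifP => _; [exact: measurable0|have [] := step [` zv]%fset].
rewrite avoidingS; split.
  by rewrite -bigcup_seq; apply: fin_bigcup_measurable => //; exact: finite_seq.
rewrite measure_fbigsetU//; last first.
  apply/trivIsetP => z z' /= _ _ ne; rewrite -subset0 => w.
  case: ifP => _ []; first by [].
  move=> [wz _]; case: ifP => _; first by [].
  move=> [wz' _]; move/eqP: ne; apply.
  by move: wz wz'; rewrite !size_rcons => -> /rcons_inj[].
rewrite big_seq_fsetE /= big_distrr -sumEFin; apply: eq_bigr => z _.
rewrite (inj_eq val_inj); case: ifP => _; last by have [_ ->] := step z.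
by rewrite measure0 mulr0 /= mulr0.
Qed.

(** A bad stack has some prefix after which some neighbour never occurs. There
    are countably many such events, each of them null because the probability of
    avoiding a state of a finite irreducible chain tends to zero. *)
Lemma good_ae : m.-negligible [set w | ~ good (stk w)].
Proof.
pose bad (x : G * G * seq G) : set (measurableTypeR R) :=
  if [&& x.1.2 \in nbr x.1.1 & all (fun c => c \in nbr x.1.1) x.2] then
    \bigcap_j avoiding x.1.1 x.1.2 x.2 j else set0.
have cT : countable [set: G * G * seq G].
  have cG := graph_countable G; rewrite -setXTT; apply: countableX.
    by rewrite -setXTT; exact: countableX.
  exact: countable_seq.
have [e eP] := countable_enum cT (o, o, [::]).
suff bad0 x : m.-negligible (bad x).
  apply: negligibleS (negligible_bigcup (fun n => bad0 (e n))) => w ngood.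
  have : exists v t K, t \in nbr v /\ forall k, (K <= k)%N -> stk w v k <> t.
    apply: contrapT => H; apply: ngood; split; first exact: stack_legal.
    move=> v t tv K; apply: contrapT => noK; apply: H; exists v, t, K; split=> // k Kk e'.
    by apply: noK; exists k.
  move=> [v [t [K [tv H]]]]; have [n en] := eP (v, t, mkseq (stk w v) K).
  exists n => //; rewrite en /bad /= tv ifT.
    move=> j _; split; first by rewrite size_mkseq.
    by move=> k /andP[]; rewrite size_mkseq => /H.
  by apply/allP => c /mapP[k _ ->]; exact: stack_legal.
case: x => [[v t] cs]; rewrite /bad /=; case: ifP => [/andP[tv /allP csv]|_]; last first.
  exact: negligible_set0.
have lastv : last (r v) cs \in nbr v.
  case/lastP: cs csv => [|cs c] csv; first exact: r_valid.
  by rewrite last_rcons; apply: csv; rewrite mem_rcons mem_head.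
have av j := @avoidingP v [` tv]%fset [` lastv]%fset cs j csv erefl.
have mbad : measurable (\bigcap_j avoiding v t cs j : set (measurableTypeR R)).
  by apply: bigcapT_measurable => j; have [] := av j.
apply/negligibleP => //; set b := (X in X = _); set c : R := \prod_(e <- _) _ in av.
have bj j : (b <= (c * avoid (p v) [` tv]%fset j [` lastv]%fset)%:E)%E.
  have [mj <-] := av j; apply: le_measure; rewrite ?inE//.
  by move=> w; apply.
have b0 : (0 <= b)%E by exact: measure_ge0.
have bfin : b \is a fin_num by rewrite ge0_fin_numE// (le_lt_trans (bj 0%N))// ltry.
rewrite -(fineK bfin); congr EFin; apply/eqP; rewrite eq_le fine_ge0// andbT.
have cvg0 := avoid_cvg0 (@trans_ge0 _ _ p v) (@trans_sum1 _ _ p v)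
  (@trans_irreducible _ _ p v) [` tv]%fset [` lastv]%fset.
have cvgc : c * avoid (p v) [` tv]%fset j [` lastv]%fset @[j --> \oo] --> (c * 0 : R).
  by apply: cvgMr.
rewrite mulr0 in cvgc; rewrite -(cvg_lim _ cvgc)//; apply: limr_ge.
  by apply/cvg_ex; exists 0.
by apply: nearW => j; rewrite -lee_fin fineK.
Qed.

End StackLaw.

Lemma rec_event_stack_walk (G : graph) (s : G -> nat -> G) q :
  rec_event q (walk_path s q) <-> visits_all (fun t => stack_queue s q t).
Proof.
rewrite /rec_event /=; split=> H v N; have [t Nt] := H v N;
  by exists t; rewrite ?queue_walk_path// -queue_walk_path.
Qed.

Section StartIndependence.
Variables (R : realType) (G : graph) (p : mechanisms R G).

(** [mu] is the law of the successive positions taken by the walkers. *)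
Definition law (r : G -> G) q (mu : {measure set (path_space G) -> \bar R}) :=
  forall ys, mu (cylinder ys) = (weight p q r ys)%:E.

Lemma law_setT r q mu : law r q mu -> mu setT = 1%E.
Proof. by move=> /(_ [::]); rewrite cylinder_nil. Qed.

Lemma law_unique r q mu mu' : law r q mu -> law r q mu' ->
  forall B, measurable B -> mu B = mu' B.
Proof.
move=> lmu lmu'; apply: (@pi_system_eq _ (path_space G) R (@path_cylinders G) mu mu') => //.
- exact: path_cylindersI.
- exact: path_cylindersT.
- by rewrite (law_setT lmu) ltry.
- by move=> _ [->|[ys ->]]; rewrite ?measure0// lmu lmu'.
Qed.

Lemma law_ex r q : (forall v, r v \in nbr v) ->
  exists mu : {measure set (path_space G) -> \bar R}, law r q mu.
Proof.
move=> rv; have [m [S [S_nbr mS]]] := random_symbols_ex p.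
have cyl := stack_walk_cylinder rv S_nbr mS q.
have [mu muE] := pushforward_measure_ex m
  (measurable_fun_cylinder (fun ys => (cyl ys).1)).
by exists mu => ys; rewrite muE (cyl ys).2.
Qed.

(** Both walks are read off the same random stacks, where the recurrence events
    coincide as soon as the stacks are good. *)
Lemma recurrence_start_indep r q q' mu mu' : (forall v, r v \in nbr v) ->
  q != [::] -> size q = size q' -> law r q mu -> law r q' mu' ->
  mu (rec_event q) = mu' (rec_event q').
Proof.
move=> rv q0 sz lmu lmu'.
have q'0 : q' != [::] by rewrite -size_eq0 -sz size_eq0.
have [m [S [S_nbr mS]]] := random_symbols_ex p.
pose walk q1 w := walk_path (stack_of (S w) r) q1.
have cyl := stack_walk_cylinder rv S_nbr mS.
have mwalk q1 : measurable_fun setT (walk q1).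
  by apply: measurable_fun_cylinder => ys; exact: (cyl q1 ys).1.
have lawE q1 mu1 : law r q1 mu1 -> mu1 (rec_event q1) = m (walk q1 @^-1` rec_event q1).
  move=> l1; have [mu2 mu2E] := pushforward_measure_ex m (mwalk q1).
  rewrite -mu2E; apply: (law_unique l1); last exact: measurable_rec_event.
  by move=> ys; rewrite mu2E (cyl q1 ys).2.
rewrite (lawE _ _ lmu) (lawE _ _ lmu').
have mrec q1 : measurable (walk q1 @^-1` rec_event q1 : set (measurableTypeR R)).
  by rewrite -[X in measurable X]setTI; apply: mwalk => //; exact: measurable_rec_event.
apply: (negligible_eq (good_ae rv S_nbr mS) (mrec q) (mrec q')) => w /contrapT gw.
split=> /rec_event_stack_walk H; apply/rec_event_stack_walk.
  exact: visits_all_queue H.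
exact: visits_all_queue (esym sz) _ H.
Qed.

End StartIndependence.

(** * The recurrence probability: harmonicity and zero-one law *)

Section RecurrenceValue.
Variables (R : realType) (G : graph) (p : mechanisms R G) (n : nat).
Hypothesis n_gt0 : (0 < n)%N.
Local Notation o := (root G).
Implicit Types (q ys : seq G) (r : G -> G) (mu : {measure set (path_space G) -> \bar R}).

Definition valid r := forall v, r v \in nbr v.

Lemma update_valid r v y : valid r -> y \in nbr v -> valid (update r v y).
Proof. by move=> rv yv w; rewrite /update; case: eqVneq => [->|]. Qed.

Lemma update_twice r v a b : update (update r v a) v b = update r v b.
Proof. by apply/funext => w; rewrite /update; case: eqVneq. Qed.

Lemma update_id r v : update r v (r v) = r.
Proof. by apply/funext => w; rewrite /update; case: eqVneq => [->|]. Qed.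

Lemma cylinder_consP y ys (Y : path G) :
  cylinder (y :: ys) Y <-> Y 0%N = y /\ cylinder ys (shift Y).
Proof.
rewrite /cylinder /mkset [size (_ :: _)]/= mkseqS_shift.
by split=> [[]|[-> ->]].
Qed.

Lemma cylinder1P y (Y : path G) : cylinder [:: y] Y <-> Y 0%N = y.
Proof. by rewrite cylinder_consP; split=> [[]|]. Qed.

Lemma cylinder_cons y ys :
  cylinder (y :: ys) = cylinder [:: y] `&` (@shift G) @^-1` cylinder ys.
Proof.
apply/seteqP; split=> Y.
  by move=> /cylinder_consP[Y0 Ys]; split=> //; exact/cylinder1P.
by move=> [/cylinder1P Y0 Ys]; exact/cylinder_consP.
Qed.

(** The Markov property at time one. *)
Lemma law_step r q y mu mu' : law p r q mu ->
  law p (update r (head o q) y) (advance q y) mu' ->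
  forall B : set (path_space G), measurable B ->
  mu (cylinder [:: y] `&` (@shift G) @^-1` B) =
  ((trans_prob p (head o q) (r (head o q)) y)%:E * mu' B)%E.
Proof.
move=> lmu lmu' B mB.
have [mu1 mu1E] := restricted_measure_ex mu (measurable_cylinder [:: y]).
have [mu2 mu2E] := pushforward_measure_ex mu1 (@measurable_shift G).
have c0 := trans_prob_ge0 p (head o q) (r (head o q)) y.
pose mu3 : {measure set (path_space G) -> \bar R} := mscale (NngNum c0) mu'.
have mu3E C : mu3 C = ((trans_prob p (head o q) (r (head o q)) y)%:E * mu' C)%E by [].
have mu2E' C : mu2 C = mu (cylinder [:: y] `&` (@shift G) @^-1` C).
  by rewrite mu2E mu1E setIC.
rewrite -mu2E' -mu3E.
apply: (@pi_system_eq _ (path_space G) R (@path_cylinders G) mu2 mu3) => //.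
- exact: path_cylindersI.
- exact: path_cylindersT.
- by rewrite mu2E' preimage_setT setIT lmu ltry.
- move=> _ [->|[ys ->]]; first by rewrite !measure0.
  by rewrite mu2E' mu3E -cylinder_cons lmu lmu' -EFinM.
Qed.

(** The common value of the recurrence probability over all starting queues of
    size [n]. *)
Definition rec_value r (x : R) := forall q mu, size q = n -> law p r q mu ->
  mu (rec_event q) = x%:E.

Lemma law_le1 r q mu B : law p r q mu -> measurable B -> (mu B <= 1)%E.
Proof.
by move=> lmu mB; rewrite -(law_setT lmu); apply: le_measure; rewrite ?inE.
Qed.

Lemma rec_value_ex r : valid r -> exists x, rec_value r x.
Proof.
move=> rv; have [mu lmu] := law_ex p (nseq n o) rv.
have fin : mu (rec_event (nseq n o)) \is a fin_num.
  rewrite ge0_fin_numE ?measure_ge0// (le_lt_trans (law_le1 lmu _)) ?ltry//.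
  exact: measurable_rec_event.
exists (fine (mu (rec_event (nseq n o)))) => q mu' sq lmu'.
rewrite fineK//; apply: (recurrence_start_indep (p := p) rv _ _ lmu' lmu).
  by rewrite -size_eq0 sq -lt0n.
by rewrite size_nseq.
Qed.

Lemma advance_size q y : size q = n -> size (advance q y) = n.
Proof. by move=> sq; rewrite size_advance// -size_eq0 sq -lt0n. Qed.

Lemma rec_cylinder_cons q y ys :
  cylinder (y :: ys) `&` rec_event q =
  cylinder [:: y] `&`
    (@shift G) @^-1` (cylinder ys `&` rec_event (advance q y)).
Proof.
apply/seteqP; split=> Y.
  move=> [/cylinder_consP[Y0 Ys] /rec_event_shift rY]; rewrite Y0 in rY.
  by split=> //; exact/cylinder1P.
move=> [/cylinder1P Y0 [Ys rY]]; split; first exact/cylinder_consP.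
by apply/rec_event_shift; rewrite Y0.
Qed.

(** The first walker is started at [v]; after its step the recurrence probability
    is that of the modified rotors, wherever the walkers now are. *)
Lemma rec_value_harmonic r v x (g : nbr v -> R) : valid r -> rec_value r x ->
  (forall y : nbr v, rec_value (update r v (val y)) (g y)) ->
  forall a : nbr v, r v = val a -> x = \sum_y p v a y * g y.
Proof.
move=> rv rx rg a ra.
pose q := nseq n v; have sq : size q = n by rewrite size_nseq.
have qv : head o q = v by rewrite /q; case: (n) n_gt0.
have [mu lmu] := law_ex p q rv.
have mrec := measurable_rec_event q.
pose U : set (path_space G) := \big[setU/set0]_(y <- nbr v) cylinder [:: y].
have mU : measurable U by apply: bigsetU_measurable => y _; exact: measurable_cylinder.
have muU (D : set (path_space G)) : measurable D ->
    mu (D `&` U) = (\sum_(y <- nbr v) mu (cylinder [:: y] `&` D))%E.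
  move=> mD; rewrite /U setIC big_distrl /= measure_fbigsetU//.
    by move=> y _; apply: measurableI => //; exact: measurable_cylinder.
  apply/trivIsetP => y z _ _ yz; rewrite -subset0 => Y.
  move=> [[/cylinder1P Yy _] [/cylinder1P Yz _]].
  by move/eqP: yz; apply; rewrite -Yy.
have nullU : mu (~` U) = 0%E.
  have muU1 : mu U = 1%E.
    rewrite -[U]setTI muU//.
    under eq_bigr do rewrite setIT lmu /= mulr1 qv.
    by rewrite sumEFin trans_prob_sum1.
  have fin : mu (~` U) \is a fin_num.
    rewrite ge0_fin_numE ?measure_ge0//; apply: le_lt_trans (law_le1 lmu _) (ltry _).
    exact: measurableC.
  have : mu setT = (mu U + mu (~` U))%E.
    by rewrite -measureU ?setUv ?setICr//; exact: measurableC.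
  rewrite (law_setT lmu) muU1 -(fineK fin) -EFinD => -[] e.
  by congr EFin; lra.
apply: EFin_inj; rewrite -(rx q mu sq lmu).
rewrite (@negligible_eq _ _ _ mu _ (rec_event q `&` U) (~` U)) //; last first.
- by move=> Y /contrapT UY; split => [|[]].
- exact: measurableI.
- by apply/negligibleP => //; exact: measurableC.
rewrite muU// big_seq_fsetE -sumEFin; apply: eq_bigr => y _.
have [mu' lmu'] := law_ex p (advance q (val y)) (update_valid rv (valP y)).
have := rec_cylinder_cons q (val y) [::].
rewrite cylinder_nil setTI => ->.
rewrite (law_step lmu (mu' := mu')) ?qv//; last exact: measurable_rec_event.
by rewrite ra trans_probE (rg y _ mu') ?EFinM// advance_size.
Qed.

(** As a function of the rotor at [v] only, the recurrence probability is harmonic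
    for the irreducible chain [p v], hence constant. *)
Lemma rec_value_update r v y x : valid r -> y \in nbr v ->
  rec_value r x -> rec_value (update r v y) x.
Proof.
move=> rv yv rx.
have /choice[g gP] (z : nbr v) : exists c, rec_value (update r v (val z)) c.
  exact/rec_value_ex/update_valid/valP.
have harm (a : nbr v) : g a = \sum_z p v a z * g z.
  apply: (rec_value_harmonic (r := update r v (val a))) => //.
  - exact/update_valid/valP.
  - by move=> z; rewrite update_twice.
  - by rewrite /update eqxx.
have gc := harmonic_constant (@trans_ge0 _ _ p v) (@trans_sum1 _ _ p v)
  (@trans_irreducible _ _ p v) harm.
have [mu lmu] := law_ex p (nseq n o) rv.
have gx : g [` rv v]%fset = x.
  apply: EFin_inj; rewrite -(rx (nseq n o) mu) ?size_nseq//.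
  by symmetry; apply: gP; rewrite /= ?size_nseq// update_id.
by rewrite -gx (gc _ [` yv]%fset); exact: (gP [` yv]%fset).
Qed.

(** Whatever the first moves, the rotors that they leave have the same recurrence
    probability as the initial ones. *)
Lemma rec_indep_cylinder ys r q mu x : valid r -> size q = n -> law p r q mu ->
  rec_value r x -> mu (cylinder ys `&` rec_event q) = (x * weight p q r ys)%:E.
Proof.
elim: ys r q mu => [|y ys IH] r q mu rv sq lmu rx.
  by rewrite cylinder_nil setTI mulr1 (rx q mu).
have mrec := measurable_rec_event q.
have [yv|yv] := boolP (y \in nbr (head o q)); last first.
  rewrite /= trans_prob_notin// mul0r mulr0.
  have m0 : mu (cylinder (y :: ys)) = 0%E by rewrite lmu /= trans_prob_notin// mul0r.
  apply: subset_measure0 m0; [|exact: measurable_cylinder|exact: subIsetl].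
  by apply: measurableI => //; exact: measurable_cylinder.
have [mu' lmu'] := law_ex p (advance q y) (update_valid rv yv).
rewrite rec_cylinder_cons (law_step lmu lmu'); last first.
  by apply: measurableI; [exact: measurable_cylinder|exact: measurable_rec_event].
rewrite (IH (update r (head o q) y))//.
- by rewrite -EFinM /= mulrCA.
- exact: update_valid.
- exact: advance_size.
- exact: rec_value_update.
Qed.

Lemma rec_value_01 r x : valid r -> rec_value r x -> x = 0 \/ x = 1.
Proof.
move=> rv rx; pose q := nseq n o; have sq : size q = n by rewrite size_nseq.
have [mu lmu] := law_ex p q rv.
have [] := @zero_one _ (path_space G) R (@path_cylinders G) mu (rec_event q).
- by [].
- exact: path_cylindersI.
- exact: path_cylindersT.
- exact: law_setT lmu.
- exact: measurable_rec_event.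
- move=> _ [->|[ys ->]]; first by rewrite set0I measure0 mule0.
  by rewrite (rec_indep_cylinder ys rv sq lmu rx) (rx q mu)// lmu.
- by rewrite (rx q mu)// => -[->]; left.
- by rewrite (rx q mu)// => -[->]; right.
Qed.

End RecurrenceValue.

(** * The law of a random walk with local memory *)

Lemma infinite_natP (A : set nat) :
  infinite_set A <-> forall N, exists2 t, (N <= t)%N & A t.
Proof.
split=> [infA N|H /finite_seqP[s sA]].
  apply: contrapT => noN; apply: infA.
  apply: (sub_finite_set _ (finite_II N)) => t At /=.
  by rewrite ltnNge; apply/negP => Nt; apply: noN; exists t.
have [t Nt] := H (\max_(i <- s) i).+1; rewrite sA /= => ts.
by move: Nt; rewrite ltnNge => /negP; apply; exact: (@leq_bigmax_seq _ _ xpredT (fun i => i)).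
Qed.

Definition plain (G : graph) (rho : rotor_config G) : G -> G := fun v => val (rho v).

Lemma plain_valid (G : graph) (rho : rotor_config G) : valid (plain rho).
Proof. by move=> v; exact: valP. Qed.

Fixpoint rotors (G : graph) (q : seq G) (r : G -> G) ys : G -> G :=
  if ys is y :: ys' then rotors (advance q y) (update r (head (root G) q) y) ys'
  else r.

Section WalkLaw.
Variables (R : realType) (G : graph) (p : mechanisms R G) (n : nat)
  (n_gt0 : (0 < n)%N).
Local Notation o := (root G).

Lemma rotors_rcons (q : seq G) r ys y :
  rotors q r (rcons ys y) =
  update (rotors q r ys) (head o (foldl (@advance G) q ys)) y.
Proof. by elim: ys q r => [|z ys IH] q r //=. Qed.

Lemma weight_rcons (q : seq G) r ys y :
  weight p q r (rcons ys y) = weight p q r ys *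
    let v := head o (foldl (@advance G) q ys) in trans_prob p v (rotors q r ys v) y.
Proof.
elim: ys q r => [|z ys IH] q r /=; first by rewrite mulrC.
by rewrite IH /= mulrA.
Qed.

Definition start_queue (x : 'I_n -> G) : seq G :=
  [seq x (turn n_gt0 k) | k <- iota 0 n].

Lemma size_start_queue x : size (start_queue x) = n.
Proof. by rewrite size_map size_iota. Qed.

Variables (x : 'I_n -> G) (rho : rotor_config G) (W : rwlm p n_gt0 x rho).
Local Notation Omega := (rwlm_space W).
Implicit Types w : Omega.

Let steps w : path_space G := fun t => rwlm_Y W t w.

Let queue_at t w := [seq rwlm_pos W t w (turn n_gt0 (t + k)) | k <- iota 0 n].

Let queue_at_head t w : head o (queue_at t w) = rwlm_pos W t w (turn n_gt0 t).
Proof.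
rewrite /queue_at (_ : iota 0 n = 0%N :: iota 1 n.-1) /= ?addn0//.
by rewrite -{1}(prednK n_gt0).
Qed.

Let turnE t t' : (turn n_gt0 t == turn n_gt0 t') = (t == t' %[mod n]).
Proof. by rewrite -val_eqE. Qed.

Let queue_atS t w : queue_at t.+1 w = advance (queue_at t w) (rwlm_Y W t w).
Proof.
have nE := prednK n_gt0.
have iota_last : iota 0 n = iota 0 n.-1 ++ [:: n.-1].
  by rewrite -{1}nE -addn1 iotaD add0n.
have iota_first : iota 0 n = 0%N :: iota 1 n.-1 by rewrite -{1}nE.
rewrite /queue_at {1}iota_last map_cat /= /advance -cats1 iota_first /=.
rewrite (iotaDl 1 0) -map_comp; congr (_ ++ [:: _]).
  apply/eq_in_map => k; rewrite mem_iota add0n /= => ltk.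
  rewrite rwlm_posS turnE addSnnS ifF //.
  apply/negbTE; rewrite -[X in _ != X %[mod n]]addn0 eqn_modDl mod0n modn_small//.
  by rewrite -nE.
by rewrite rwlm_posS turnE addSnnS nE modnDr eqxx.
Qed.

Lemma queue_steps t w : queue (start_queue x) (steps w) t = queue_at t w.
Proof.
elim: t => [|t IH]; last by rewrite queueS IH queue_atS.
by rewrite /queue /= /queue_at; under eq_map do rewrite rwlm_pos0.
Qed.

Lemma rotors_steps t w :
  rotors (start_queue x) (plain rho) (mkseq (steps w) t) = plain (rwlm_rotor W t w).
Proof.
elim: t => [|t IH]; first by rewrite /= rwlm_rotor0.
rewrite mkseqS rotors_rcons IH -/(queue _ _ _) queue_steps queue_at_head.
by apply/funext => u; rewrite /plain rwlm_rotorS.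
Qed.

Let mem_queue_at t w v : v \in queue_at t w <-> exists j, rwlm_pos W t w j = v.
Proof.
split=> [/mapP[k _ ->]|[j <-]]; first by eexists.
have lt : (t %% n < n)%N by rewrite ltn_mod.
apply/mapP; exists ((j + (n - t %% n)) %% n)%N.
  by rewrite mem_iota add0n ltn_mod.
congr (rwlm_pos W t w _); apply/val_inj => /=.
rewrite modnDmr -modnDml addnCA subnKC ?(ltnW lt)// modnDr.
by rewrite modn_small.
Qed.

Lemma recurrent_steps w :
  recurrent (rwlm_pos W ^~ w) <-> rec_event (start_queue x) (steps w).
Proof.
rewrite /recurrent /rec_event /visits_all /=; split=> H v.
  move=> N; have /infinite_natP/(_ N)[t Nt vt] := H v.
  by exists t => //; rewrite queue_steps; exact/mem_queue_at.
apply/infinite_natP => N; have [t Nt vt] := H v N.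
by exists t => //=; apply/mem_queue_at; rewrite -queue_steps.
Qed.

Let step_nbr t w : rwlm_Y W t w \in nbr (rwlm_pos W t w (turn n_gt0 t)).
Proof.
have := rwlm_rotorS t w (rwlm_pos W t w (turn n_gt0 t)).
by rewrite eqxx => <-; exact: valP.
Qed.

(** The event that the first moves are [ys] is the event that the past coincides
    with the past of any given point [w0] of it, so that the sampling rule applies
    with the history of [w0]. *)
Lemma steps_cylinder ys :
  rwlm_prob W (steps @^-1` cylinder ys) = (weight p (start_queue x) (plain rho) ys)%:E.
Proof.
elim/last_ind: ys => [|ys y IH].
  by rewrite cylinder_nil preimage_setT probability_setT.
rewrite weight_rcons EFinM -IH.
have cylE : steps @^-1` cylinder (rcons ys y) =
    steps @^-1` cylinder ys `&` [set w | rwlm_Y W (size ys) w = y].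
  apply/seteqP; split=> w; rewrite /cylinder /= size_rcons mkseqS.
    by move=> /rcons_inj[].
  by move=> [-> wy]; rewrite -[in RHS]wy.
rewrite cylE.
have [[w0 w0ys]|/nonemptyPn ys0] := pselect (steps @^-1` cylinder ys !=set0);
  last first.
  by rewrite ys0 set0I measure0 mul0e.
set t := size ys.
have rE := rotors_steps t w0; rewrite [mkseq _ _]w0ys in rE.
have qE := queue_steps t w0; rewrite /queue [mkseq _ _]w0ys in qE.
rewrite {}rE qE queue_at_head /=.
set v := rwlm_pos W t w0 _.
have pastE : steps @^-1` cylinder ys = [set w | forall s, (s <= t)%N ->
    (rwlm_pos W s w, rwlm_rotor W s w) = (rwlm_pos W s w0, rwlm_rotor W s w0)].
  apply/seteqP; split=> w.
    move=> wys; elim=> [|s IHs] st; first by rewrite !rwlm_pos0 !rwlm_rotor0.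
    have [ep er] := IHs (ltnW st).
    have eY : rwlm_Y W s w = rwlm_Y W s w0.
      by rewrite -!/(steps _ s) (iffLR (cylinderP _ _) wys)// (iffLR (cylinderP _ _) w0ys).
    congr pair; first by apply/funext => j; rewrite !rwlm_posS eY ep.
    apply: functional_extensionality_dep => u; apply/val_inj.
    by rewrite !rwlm_rotorS eY ep er.
  move=> H; apply/cylinderP => s st; rewrite -(iffLR (cylinderP _ _) w0ys)//.
  have [ep er] := H s (ltnW st); have [_ er'] := H s.+1 st.
  have := rwlm_rotorS s w (rwlm_pos W s w (turn n_gt0 s)).
  have := rwlm_rotorS s w0 (rwlm_pos W s w0 (turn n_gt0 s)).
  by rewrite !eqxx er' ep => e0 e1; rewrite /steps -e0 -e1.
have [yv|yv] := boolP (y \in nbr v); last first.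
  rewrite trans_prob_notin// mule0 (_ : _ `&` _ = set0) ?measure0//.
  rewrite -subset0 => w [wys wy]; rewrite pastE in wys.
  have [ep _] := wys t (leqnn t); move/negP: yv; apply.
  by rewrite -wy /v -ep; exact: step_nbr.
have := @rwlm_sample _ _ _ _ _ _ _ W t (fun s => (rwlm_pos W s w0, rwlm_rotor W s w0)) [` yv]%fset.
by rewrite /= -pastE => ->; rewrite -[y in trans_prob _ _ _ y]/(val [` yv]%fset) trans_probE.
Qed.

Lemma recurrence_prob_law : exists mu : {measure set (path_space G) -> \bar R},
  law p (plain rho) (start_queue x) mu /\
  recurrence_prob W = mu (rec_event (start_queue x)).
Proof.
have msteps : measurable_fun setT steps.
  by apply: measurable_path_fun => t y; exact: (rwlm_Y_measurable ).
have [mu muE] := pushforward_measure_ex (rwlm_prob W) msteps.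
exists mu; split; first by move=> ys; exact: etrans (muE _) (steps_cylinder ys).
rewrite muE /recurrence_prob; congr (rwlm_prob W _).
by apply/seteqP; split=> w /recurrent_steps.
Qed.

End WalkLaw.

(** * Tail events of independent uniform rotors *)

Section RotorSpace.
Variables (R : realType) (G : graph).
Implicit Types (rho c : rotor_config G) (v : G) (s : seq G).

Definition set_rotor rho v (b : nbr v) : rotor_config G :=
  fun w => insubd (rho w) (update (plain rho) v (val b) w).

Lemma set_rotor_eq rho v (b : nbr v) : set_rotor rho b v = b.
Proof. by apply/val_inj; rewrite /set_rotor val_insubd /update eqxx (valP b). Qed.

Lemma set_rotor_neq rho v (b : nbr v) w : w != v -> set_rotor rho b w = rho w.
Proof.
move=> wv; apply/val_inj.
by rewrite /set_rotor val_insubd /update (negbTE wv) (valP (rho w)).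
Qed.

Lemma plain_set_rotor rho v (b : nbr v) :
  plain (set_rotor rho b) = update (plain rho) v (val b).
Proof.
apply/funext => w; rewrite /plain /update.
by have [->|wv] := eqVneq w v; rewrite ?set_rotor_eq ?set_rotor_neq.
Qed.

Definition box s c : set (rotor_space G) := [set rho | forall x, x \in s -> rho x = c x].

Definition boxes : set (set (rotor_config G)) :=
  [set C | C = set0 \/ exists s c, C = box s c].

Lemma box_cons v s c : box (v :: s) c = [set rho | rho v = c v] `&` box s c.
Proof.
apply/seteqP; split=> rho.
  by move=> H; split=> [|x xs]; apply: H; rewrite inE ?eqxx ?xs ?orbT.
by move=> [H1 H2] x; rewrite inE => /orP[/eqP ->|/H2].
Qed.

Lemma measurable_rotor v (y : nbr v) :
  measurable ([set rho | rho v = y] : set (rotor_space G)).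
Proof. by apply: sub_sigma_algebra; exists v, y. Qed.

Lemma measurable_box s c : measurable (box s c).
Proof.
elim: s => [|v s IH].
  by rewrite (_ : box [::] c = setT)//; apply/seteqP; split=> // rho _ x.
by rewrite box_cons; apply: measurableI => //; exact: measurable_rotor.
Qed.

Lemma boxesI : setI_closed boxes.
Proof.
move=> _ _ [->|[s [c ->]]] [->|[s' [c' ->]]]; rewrite ?set0I ?setI0; try by left.
have [agree|] := pselect (forall x, x \in s -> x \in s' -> c x = c' x); last first.
  move=> /existsNP[x /not_implyP[xs /not_implyP[xs' ne]]]; left.
  by rewrite -subset0 => rho [/(_ x xs) e /(_ x xs') e']; apply: ne; rewrite -e.
right; exists (s ++ s'), (fun x => if x \in s then c x else c' x).
apply/seteqP; split=> rho.
  by move=> [H H'] x; rewrite mem_cat; case: ifP => [/H|_ /H'].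
move=> H; split=> x xs; have := H x; rewrite mem_cat xs ?orbT => /(_ isT) //.
by case: ifP => // xs' ->; exact: agree.
Qed.

Lemma boxesT : boxes setT.
Proof.
right; exists [::], (fun x => [` plain_valid point x]%fset).
by apply/seteqP; split.
Qed.

Lemma measurable_boxes : @measurable _ (rotor_space G) = <<s boxes >>.
Proof.
apply/seteqP; split; apply: smallest_sub; try exact: smallest_sigma_algebra.
  move=> _ [x [y ->]]; apply: sub_sigma_algebra; right.
  exists [:: x], (set_rotor point y); apply/seteqP; split=> rho.
    by move=> rxy z; rewrite inE => /eqP ->; rewrite set_rotor_eq.
  by move=> /(_ x (mem_head _ _)); rewrite set_rotor_eq.
by move=> _ [->|[s [c ->]]]; [exact: measurable0|exact: measurable_box].
Qed.

Definition swap_rotor v (y z : nbr v) rho : rotor_config G :=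
  set_rotor rho (tperm y z (rho v)).

Lemma swap_rotor_box v (y z : nbr v) s c :
  (swap_rotor y z : rotor_space G -> rotor_space G) @^-1` box s c =
  box s (swap_rotor y z c).
Proof.
apply/seteqP; split=> rho H x xs; have := H x xs; rewrite /swap_rotor;
  case: (eqVneq x v) => [->|xv]; rewrite ?set_rotor_eq ?set_rotor_neq//.
  by move=> <-; rewrite tpermK.
by move=> ->; rewrite tpermK.
Qed.

Lemma measurable_swap_rotor v (y z : nbr v) :
  measurable_fun setT (swap_rotor y z : rotor_space G -> rotor_space G).
Proof.
apply: (@measurability _ _ _ (rotor_space G) setT _ boxes).
  exact: measurable_boxes.
move=> _ [_ [->|[s [c ->]]] <-]; rewrite setTI ?preimage_set0//.
by rewrite swap_rotor_box; exact: measurable_box.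
Qed.

Variables (IUD : probability (rotor_space G) R) (IUD_P : is_IUD IUD).

Lemma IUD_box (s : {fset G}) c c' : IUD (box s c) = IUD (box s c').
Proof.
rewrite (IUD_independent IUD_P s (fun x => [set c x])).
rewrite (IUD_independent IUD_P s (fun x => [set c' x])).
by apply: eq_bigr => x _; rewrite !(IUD_uniform IUD_P).
Qed.

(** All boxes over the same set of vertices have the same measure, and a
    transposition of the values at [v] maps boxes to boxes. *)
Lemma IUD_swap v (y z : nbr v) (B : set (rotor_space G)) : measurable B ->
  IUD (swap_rotor y z @^-1` B) = IUD B.
Proof.
move=> mB; have [mu muE] := pushforward_measure_ex IUD (measurable_swap_rotor y z).
rewrite -muE; apply: (@pi_system_eq _ (rotor_space G) R boxes mu IUD) => //.
- exact: measurable_boxes.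
- exact: boxesI.
- exact: boxesT.
- rewrite muE preimage_setT; apply: le_lt_trans (probability_le1 IUD _) (ltry 1).
  exact: measurableT.
- move=> _ [->|[s [c ->]]]; first by rewrite !measure0.
  rewrite muE swap_rotor_box.
  have fsE c' : box s c' = box [fset x in s]%fset c'.
    apply/seteqP; split=> rho H x xs; apply: H; first by rewrite inE in xs.
    by rewrite inE.
  by rewrite !fsE; exact: IUD_box.
Qed.

Definition site_invariant v (A : set (rotor_space G)) :=
  forall rho (b : nbr v), A rho -> A (set_rotor rho b).

Lemma set_rotor_id rho v : set_rotor rho (rho v) = rho.
Proof.
apply: functional_extensionality_dep => w.
by have [->|wv] := eqVneq w v; rewrite ?set_rotor_eq ?set_rotor_neq.
Qed.

Lemma set_rotor_twice rho v (a b : nbr v) : set_rotor (set_rotor rho a) b = set_rotor rho b.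
Proof.
apply: functional_extensionality_dep => w.
by have [->|wv] := eqVneq w v; rewrite ?set_rotor_eq ?set_rotor_neq.
Qed.

(** The transpositions at [v] preserve both the measure and [A], so the parts of
    [A] cut out by the possible values of the rotor at [v] have equal measure. *)
Lemma IUD_site_invariant v (A : set (rotor_space G)) (y : nbr v) :
  measurable A -> site_invariant v A ->
  IUD ([set rho | rho v = y] `&` A) = (IUD A * (#|` nbr v|%:R^-1)%:E)%E.
Proof.
move=> mA invA.
have mAz (z : nbr v) : measurable ([set rho | rho v = z] `&` A : set (rotor_space G)).
  by apply: measurableI => //; exact: measurable_rotor.
have same z : IUD ([set rho | rho v = z] `&` A) = IUD ([set rho | rho v = y] `&` A).
  rewrite -(IUD_swap y z (mAz z)); congr (IUD _); apply/seteqP; split=> rho.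
    move=> [/=]; rewrite /swap_rotor set_rotor_eq => e Arho; split.
      by rewrite -(tpermK y z (rho v)) e tpermR.
    by rewrite -(set_rotor_id rho v) -(set_rotor_twice rho (tperm y z (rho v))); exact: invA.
  move=> [/= e Arho]; rewrite /swap_rotor; split; last exact: invA.
  by rewrite /= set_rotor_eq e tpermL.
pose F x : set (rotor_space G) := [set rho | plain rho v = x] `&` A.
have FE (z : nbr v) : F (val z) = [set rho | rho v = z] `&` A.
  congr (_ `&` _); apply/seteqP; split=> rho /= [e]; last by rewrite /plain e.
  exact/val_inj.
have AE : A = \big[setU/set0]_(x <- nbr v) F x.
  rewrite -bigcup_seq; apply/seteqP; split=> rho; last by move=> [x _ []].
  by move=> Arho; exists (plain rho v) => //; exact: valP.
have mAfin : IUD A \is a fin_num by exact: fin_num_measure.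
have : IUD A = (\sum_(z : nbr v) IUD ([set rho | rho v = z] `&` A))%E.
  rewrite {1}AE measure_fbigsetU; last 2 first.
  - by move=> x xv; rewrite -[x]/(val [` xv]%fset) FE.
  - apply/trivIsetP => x x' _ _ xx'; rewrite -subset0 => rho [[/= e _] [/= e' _]].
    by move/eqP: xx'; apply; rewrite -e.
  by rewrite big_seq_fsetE; apply: eq_bigr => z _; rewrite FE.
under eq_bigr do rewrite same.
have bfin : IUD ([set rho | rho v = y] `&` A) \is a fin_num by exact: fin_num_measure.
rewrite -(fineK mAfin) -(fineK bfin) sumEFin sumr_const -cardfE => -[] e.
rewrite -EFinM e -[X in X * _^-1]mulr_natr mulfK//.
by rewrite pnatr_eq0 cardfs_eq0; apply/fset0Pn; exists (val y); exact: valP.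
Qed.

(** Sites are added one at a time: the intersection of [A] with a box over the
    other sites is still invariant at the new one. *)
Lemma IUD_box_indep (s : seq G) c (A : set (rotor_space G)) : uniq s ->
  measurable A -> (forall v, site_invariant v A) ->
  IUD (box s c `&` A) = (IUD A * (\prod_(x <- s) (#|` nbr x|%:R^-1))%:E)%E.
Proof.
move=> + mA invA; elim: s => [_|v s IH /= /andP[vs us]].
  rewrite (_ : box [::] c = setT); first by rewrite setTI big_nil mule1.
  by apply/seteqP; split.
rewrite box_cons -setIA IUD_site_invariant.
- by rewrite IH// big_cons mulrC EFinM muleA.
- by apply: measurableI => //; exact: measurable_box.
- move=> rho b [H Arho]; split; last exact: invA.
  move=> x xs; rewrite set_rotor_neq ?H//.
  by apply: contraNneq vs => <-.
Qed.

Lemma IUD_tail (A : set (rotor_space G)) :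
  measurable A -> (forall v, site_invariant v A) -> IUD A = 0%E \/ IUD A = 1%E.
Proof.
move=> mA invA; apply: (@zero_one _ (rotor_space G) R boxes IUD A) => //.
- exact: measurable_boxes.
- exact: boxesI.
- exact: boxesT.
- exact: probability_setT.
move=> _ [->|[s [c ->]]]; first by rewrite set0I measure0 mule0.
have boxE : box s c = box (undup s) c.
  by apply/seteqP; split=> rho H x xs; apply: H; rewrite ?mem_undup// -mem_undup.
have E1 := IUD_box_indep c (undup_uniq s) mA invA.
have E2 := IUD_box_indep c (undup_uniq s) (@measurableT _ (rotor_space G))
  (fun _ _ _ => id).
rewrite setIT probability_setT mul1e in E2.
by rewrite boxE; apply: etrans E1 _; congr (_ * _)%E; exact: esym E2.
Qed.

End RotorSpace.

(** * The dichotomy *)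

Section Measurability.
Variables (R : realType) (G : graph) (p : mechanisms R G).

Lemma measurable_plain v a :
  measurable ([set rho | plain rho v = a] : set (rotor_space G)).
Proof.
have [av|av] := boolP (a \in nbr v).
  rewrite (_ : [set _ | _] = [set rho : rotor_space G | rho v = [` av]%fset]).
    exact: measurable_rotor.
  by apply/seteqP; split=> rho /= e; [exact/val_inj|rewrite /plain e].
rewrite (_ : [set _ | _] = set0); first exact: measurable0.
by rewrite -subset0 => rho /= e; move: av; rewrite -e (valP (rho v)).
Qed.

Lemma measurable_weight (F : rotor_space G -> G -> G) q ys :
  (forall v a, measurable [set rho | F rho v = a]) ->
  measurable_fun setT (fun rho => weight p q (F rho) ys).
Proof.
elim: ys q F => [|y ys IH] q F mF /=; first exact: measurable_cst.
apply: measurable_funM.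
  move=> _ B mB; rewrite setTI.
  apply: (@preimage_countable_measurable _ (rotor_space G) G
    (fun rho => F rho (head (root G) q)) [set a | B (trans_prob p _ a y)]).
    exact: graph_countable.
  by move=> a; exact: mF.
apply: (IH _ (fun rho => update (F rho) (head (root G) q) y)) => v a.
rewrite /update; case: eqVneq => _; last exact: mF.
have [->|ya] := eqVneq y a.
  by rewrite (_ : [set _ | _] = setT)//; apply/seteqP; split.
by rewrite (_ : [set _ | _] = set0)// -subset0 => rho /= e; rewrite e eqxx in ya.
Qed.

(** By the pi-lambda theorem it suffices to consider cylinders, whose probabilities
    depend on finitely many rotors. *)
Lemma measurable_law q (mu : rotor_space G -> {measure set (path_space G) -> \bar R}) :
  (forall rho, law p (plain rho) q (mu rho)) ->
  forall B, measurable B -> measurable_fun setT (fun rho => mu rho B).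
Proof.
move=> lmu B mB.
have mset C : (forall rho, mu rho C = 1%E) -> measurable_fun setT (fun rho => mu rho C).
  by move=> H; apply: (eq_measurable_fun (cst 1%E)) => [rho _|]; rewrite ?H//.
apply: (@dynkin_induction _ (path_space G) (@path_cylinders G)
  (fun B => measurable_fun setT (fun rho => mu rho B))) => //.
- exact: path_cylindersI.
- by apply: mset => rho; exact: law_setT (lmu rho).
- move=> _ [->|[ys ->]].
    by apply: (eq_measurable_fun (cst 0%E)) => [rho _|]; rewrite ?measure0.
  apply: (eq_measurable_fun (fun rho : rotor_space G => (weight p q (plain rho) ys)%:E)).
    by move=> rho _; rewrite lmu.
  apply/measurable_EFinP; apply: measurable_weight; exact: measurable_plain.
- move=> S mS HS.
  apply: (eq_measurable_fun (fun rho : rotor_space G => (1 - mu rho S)%E)); last first.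
    by apply: emeasurable_funB => //; exact: measurable_cst.
  move=> rho _; have muT := law_setT (lmu rho).
  have fin C : measurable C -> mu rho C \is a fin_num.
    move=> mC; rewrite ge0_fin_numE ?measure_ge0//.
    by apply: le_lt_trans (law_le1 (lmu rho) mC) (ltry _).
  have : mu rho setT = (mu rho S + mu rho (~` S))%E.
    by rewrite -measureU ?setUv ?setICr//; exact: measurableC.
  by rewrite muT => ->; rewrite addeAC subee ?add0e//; exact: fin.
- move=> F mF tF HF.
  apply: (eq_measurable_fun (fun rho : rotor_space G => \sum_(0 <= k <oo) mu rho (F k))%E).
    by move=> rho _; rewrite measure_semi_bigcup//; exact: bigcup_measurable.
  exact: ge0_emeasurable_sum.
Qed.

End Measurability.

Theorem proposition2p10 (R : realType) (G : graph) (p : mechanisms R G)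
    (n : nat) (n_gt0 : (0 < n)%N)
    (W : forall (x : 'I_n -> G) (rho : rotor_config G), rwlm p n_gt0 x rho)
    (IUD : probability (rotor_space G) R) (IUD_P : is_IUD IUD) :
  let scenario (q : \bar R) :=
    {ae IUD, forall rho : rotor_space G, p_rec_eq W rho q} in
  (scenario 0%E /\ ~ scenario 1%E) \/ (~ scenario 0%E /\ scenario 1%E).
Proof.
move=> scenario; pose x0 : 'I_n -> G := fun=> root G.
have /choice[mu muP] rho := recurrence_prob_law (W x0 rho).
pose A : set (rotor_space G) := [set rho | rec_value p n (plain rho) 1].
have p_recP rho c : rec_value p n (plain rho) c -> p_rec_eq W rho c%:E.
  move=> rc x; have [mu' [lmu' ->]] := recurrence_prob_law (W x rho).
  by apply: rc lmu'; exact: size_start_queue.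
have prec_uniq rho c c' : p_rec_eq W rho c -> p_rec_eq W rho c' -> c = c'.
  by move=> /(_ x0) <- /(_ x0).
have value01 rho : rec_value p n (plain rho) 0 \/ rec_value p n (plain rho) 1.
  have rv := plain_valid rho; have [c rc] := rec_value_ex p n_gt0 rv.
  by have [c0|c1] := rec_value_01 n_gt0 rv rc; [left; rewrite -c0|right; rewrite -c1].
have ne01 : 0%E <> 1%E :> \bar R by move=> [] /esym/eqP; rewrite oner_eq0.
have A1 rho : A rho <-> p_rec_eq W rho 1%E.
  split=> [/p_recP //|p1]; have [/p_recP p0|//] := value01 rho.
  by have := ne01 (prec_uniq _ _ _ p0 p1).
have A0 rho : ~ A rho <-> p_rec_eq W rho 0%E.
  split=> [nA|p0 /A1 p1]; last exact: ne01 (prec_uniq _ _ _ p0 p1).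
  by have [/p_recP|/nA] := value01 rho.
have mA : measurable A.
  have AE : A = (fun rho => mu rho (rec_event (start_queue n_gt0 x0))) @^-1` [set 1%E].
    apply/seteqP; split=> rho; last first.
      by move=> /= e; have [/p_recP/(_ x0)|//] := value01 rho; rewrite (muP rho).2 e => /esym.
    by move=> /A1/(_ x0); rewrite (muP rho).2.
  rewrite AE -[X in measurable X]setTI.
  apply: (measurable_law (p := p) (q := start_queue n_gt0 x0)) => //.
  - by move=> rho; exact: (muP rho).1.
  - exact: measurable_rec_event.
have invA v : site_invariant v A.
  move=> rho b; rewrite /A /= plain_set_rotor.
  by apply: rec_value_update => //; [exact: plain_valid|exact: valP].
have s1 : scenario 1%E <-> IUD (~` A) = 0%E.
  rewrite -(negligibleP _ (measurableC mA)) /scenario.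
  by split; apply: negligibleS => rho /= H; [move=> /A1|move=> /A1].
have s0 : scenario 0%E <-> IUD A = 0%E.
  rewrite -(negligibleP _ mA) /scenario.
  split; apply: negligibleS => rho /= H; first by move=> /A0.
  by apply: contrapT => /A0.
have IUDC := probability_setC IUD mA.
have [IA|IA] := IUD_tail IUD_P mA invA; rewrite s0 s1 IUDC IA.
  by left; split=> //; rewrite sube0 => /esym.
by right; split; [exact/nesym|rewrite subee].
Qed.
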